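(* Let $f:\mathbb{R}^d\to\mathbb{R}$ be twice differentiable, strictly convex and strongly self-concordant with parameter $M>0$, with minimizer $x_*$. Let $0<\alpha<\beta<1$ with $\alpha<\frac12$. Let $x_0\in\mathbb{R}^d$ be any initial point, $B_0\in\mathbb{S}^d_{++}$ any initial Hessian approximation, and let $\{x_t\}_{t\ge 0}$ be generated by the BFGS method with step sizes satisfying the Armijo–Wolfe conditions with parameters $\alpha,\beta$, where the unit step is tried first (i.e. $\eta_t=1$ is chosen whenever $\eta=1$ satisfies the Armijo–Wolfe conditions at iteration $t$). Then for every integer $t\ge1$, $$\frac{f(x_t)-f(x_* )}{f(x_0)-f(x_* )}\le\left(\frac{\delta_6t_0+\delta_7\Psi(\tilde B_0)+\delta_8D_0\left(\Psi(\bar B_0)+\frac{3(1+D_0)^2}{\alpha(1-\beta)}\right)}{t}\right)^{t},$$ where $$t_0:=\max\left\{\Psi(\bar B_0),\ \frac{3(1+D_0)^2}{\alpha(1-\beta)}\log\frac{C_0}{\delta_1}\right\}$$ and the constants $\delta_1,\delta_6,\delta_7,\delta_8$ are those given in the context.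
   Context: $\mathbb{S}^d_{++}$ is the set of $d\times d$ symmetric positive definite matrices; $A\preceq B$ means $B-A$ is positive semidefinite. Strict convexity means $\nabla^2 f(x)\succ 0$ for all $x$. For $x,u\in\mathbb{R}^d$, $\|u\|_x:=\sqrt{u^\top\nabla^2 f(x)u}$. $f$ is strongly self-concordant with parameter $M>0$ if for all $x,y,z\in\mathbb{R}^d$, $\nabla^2 f(x)-\nabla^2 f(y)\preceq M\|x-y\|_z\nabla^2 f(y)$. $f$ is assumed to have a (unique) minimizer $x_*$. BFGS method: with $g_t=\nabla f(x_t)$, set $d_t=-B_t^{-1}g_t$, $x_{t+1}=x_t+\eta_t d_t$ with $\eta_t>0$, $s_t=x_{t+1}-x_t$, $y_t=\nabla f(x_{t+1})-\nabla f(x_t)$, and $B_{t+1}=B_t-\frac{B_ts_ts_t^\top B_t}{s_t^\top B_ts_t}+\frac{y_ty_t^\top}{s_t^\top y_t}$. It is understood that $g_t\ne 0$ along the run, so that everything is well defined. Armijo–Wolfe conditions: $f(x_t+\eta_td_t)\le f(x_t)+\alpha\eta_t\nabla f(x_t)^\top d_t$ and $\nabla f(x_t+\eta_td_t)^\top d_t\ge\beta\nabla f(x_t)^\top d_t$. $\Psi(A):=\mathrm{Tr}(A)-d-\log\det(A)$ for $A\in\mathbb{S}^d_{++}$. $\omega(x):=x-\log(1+x)$ for $x>-1$, and $\omega^{-1}:[0,\infty)\to[0,\infty)$ is the inverse of $\omega$ restricted to $[0,\infty)$. $C_t:=f(x_t)-f(x_* )$, $D_t:=2\omega^{-1}(M^2C_t/4)$.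 $\tilde B_0:=\nabla^2 f(x_* )^{-1/2}B_0\nabla^2 f(x_* )^{-1/2}$ and $\bar B_0:=\frac{1}{1+D_0}\tilde B_0$. Constants: $\delta_1:=\min\left\{\frac1{16},\ \frac4{M^2}\omega\left(\frac1{32}\right),\ \frac4{M^2}\omega\left(\frac{\sqrt{2(1-\alpha)}-1}{2}\right),\ \frac4{M^2}\omega\left(\frac12\left(\frac1{\sqrt{1-\beta}}-1\right)\right)\right\}$, $\delta_2:=\max\left\{\frac{15}{16},\frac1{\sqrt{2(1-\alpha)}}\right\}$, $\delta_3:=\frac1{\sqrt{1-\beta}}$, $\delta_4:=\frac{1}{\min\{\omega(\delta_2-1),\,\omega(\delta_3-1)\}}$, $\delta_5:=\max\left\{\frac{2+2/\delta_2}{2\delta_2-17/16},\ \frac{4\delta_3}{2\delta_2-17/16}\right\}$, $\delta_6:=\log\frac{1}{2\alpha(1-\beta)}$, $\delta_7:=1+\delta_4\delta_6+\delta_5$, $\delta_8:=2+2\delta_4\delta_6+2\delta_5+\frac{2\delta_2-1/16-\log\delta_2}{2\delta_2-17/16}$. *)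

(* Defs.v *)
From HB Require Import structures.
From mathcomp Require Import all_boot all_order all_algebra.
From mathcomp Require Import all_classical all_reals all_analysis.
Set Implicit Arguments.
Unset Strict Implicit.
Unset Printing Implicit Defensive.
Import Order.TTheory GRing.Theory Num.Theory.
Import numFieldNormedType.Exports.
Local Open Scope classical_set_scope.
Local Open Scope ring_scope.

Definition dot (R : realType) (d : nat) (u v : 'cV[R]_d) : R :=
  (u^T *m v) 0 0.

Definition posdefmx (R : realType) (d : nat) (A : 'M[R]_d) : Prop :=
  A^T = A /\ forall u : 'cV[R]_d, u != 0 -> 0 < dot u (A *m u).

Definition possemidefmx (R : realType) (d : nat) (A : 'M[R]_d) : Prop :=
  A^T = A /\ forall u : 'cV[R]_d, 0 <= dot u (A *m u).

Definition loewner_le (R : realType) (d : nat) (A B : 'M[R]_d) : Prop :=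
  possemidefmx (B - A).

(* The positive definite square root; meaningful (existing and unique) when A
   is positive definite, and 0 by convention when there is none. *)
Definition sqrtmx (R : realType) (d : nat) (A : 'M[R]_d) : 'M[R]_d :=
  xget 0 [set S : 'M[R]_d | posdefmx S /\ S *m S = A].

Definition gradient (R : realType) (d : nat) (f : 'cV[R]_d -> R)
    (x : 'cV[R]_d) : 'cV[R]_d :=
  \col_(i < d) 'D_(delta_mx i 0) f x.

Definition hessian (R : realType) (d : nat) (f : 'cV[R]_d -> R)
    (x : 'cV[R]_d) : 'M[R]_d :=
  \matrix_(i < d, j < d)
    'D_(delta_mx i 0) (fun z => 'D_(delta_mx j 0) f z) x.

(* Frechet differentiability of f and of its gradient. *)
Definition twice_differentiable (R : realType) (d : nat)
    (f : 'cV[R]_d -> R) : Prop :=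
  (forall x, differentiable f x) /\ (forall x, differentiable (gradient f) x).

Definition strictly_convex (R : realType) (d : nat)
    (f : 'cV[R]_d -> R) : Prop :=
  forall x, posdefmx (hessian f x).

Definition local_norm (R : realType) (d : nat) (f : 'cV[R]_d -> R)
    (x u : 'cV[R]_d) : R :=
  Num.sqrt (dot u (hessian f x *m u)).

Definition strongly_self_concordant (R : realType) (d : nat) (M : R)
    (f : 'cV[R]_d -> R) : Prop :=
  forall x y z : 'cV[R]_d,
    loewner_le (hessian f x - hessian f y)
               ((M * local_norm f z (x - y)) *: hessian f y).

Definition minimizer (R : realType) (d : nat) (f : 'cV[R]_d -> R)
    (xs : 'cV[R]_d) : Prop :=
  forall x, f xs <= f x.

Definition bfgs_direction (R : realType) (d : nat) (f : 'cV[R]_d -> R)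
    (B : 'M[R]_d) (x : 'cV[R]_d) : 'cV[R]_d :=
  - (invmx B *m gradient f x).

Definition bfgs_update (R : realType) (d : nat) (B : 'M[R]_d)
    (s y : 'cV[R]_d) : 'M[R]_d :=
  B - (dot s (B *m s))^-1 *: (B *m s *m s^T *m B)
    + (dot s y)^-1 *: (y *m y^T).

Definition bfgs_run (R : realType) (d : nat) (f : 'cV[R]_d -> R)
    (x : nat -> 'cV[R]_d) (B : nat -> 'M[R]_d) (eta : nat -> R) : Prop :=
  forall t,
    [/\ gradient f (x t) != 0,
        0 < eta t,
        x t.+1 = x t + eta t *: bfgs_direction f (B t) (x t) &
        B t.+1 = bfgs_update (B t) (x t.+1 - x t)
                   (gradient f (x t.+1) - gradient f (x t))].

Definition armijo_wolfe (R : realType) (d : nat) (f : 'cV[R]_d -> R)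
    (alpha beta : R) (x p : 'cV[R]_d) (eta : R) : Prop :=
  f (x + eta *: p) <= f x + alpha * eta * dot (gradient f x) p /\
  beta * dot (gradient f x) p <= dot (gradient f (x + eta *: p)) p.

Definition Psi (R : realType) (d : nat) (A : 'M[R]_d) : R :=
  \tr A - d%:R - ln (\det A).

Definition omega (R : realType) (x : R) : R := x - ln (1 + x).

Definition omega_inv (R : realType) : R -> R :=
  'pinv_(fun=> 0) [set x : R | 0 <= x] (@omega R).

Definition gap (R : realType) (d : nat) (f : 'cV[R]_d -> R)
    (xs x : 'cV[R]_d) : R := f x - f xs.

Definition Dgap (R : realType) (d : nat) (f : 'cV[R]_d -> R) (M : R)
    (xs x : 'cV[R]_d) : R := 2 * omega_inv (M ^+ 2 * gap f xs x / 4).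

Definition tildemx (R : realType) (d : nat) (f : 'cV[R]_d -> R)
    (xs : 'cV[R]_d) (B : 'M[R]_d) : 'M[R]_d :=
  invmx (sqrtmx (hessian f xs)) *m B *m invmx (sqrtmx (hessian f xs)).

Definition delta1 (R : realType) (M alpha beta : R) : R :=
  Num.min (1 / 16)
  (Num.min (4 / M ^+ 2 * omega (1 / 32))
  (Num.min (4 / M ^+ 2 * omega ((Num.sqrt (2 * (1 - alpha)) - 1) / 2))
           (4 / M ^+ 2 * omega (1 / 2 * (1 / Num.sqrt (1 - beta) - 1))))).

Definition delta2 (R : realType) (alpha : R) : R :=
  Num.max (15 / 16) (1 / Num.sqrt (2 * (1 - alpha))).

Definition delta3 (R : realType) (beta : R) : R := 1 / Num.sqrt (1 - beta).

Definition delta4 (R : realType) (alpha beta : R) : R :=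
  1 / Num.min (omega (delta2 alpha - 1)) (omega (delta3 beta - 1)).

Definition delta5 (R : realType) (alpha beta : R) : R :=
  Num.max ((2 + 2 / delta2 alpha) / (2 * delta2 alpha - 17 / 16))
          ((4 * delta3 beta) / (2 * delta2 alpha - 17 / 16)).

Definition delta6 (R : realType) (alpha beta : R) : R :=
  ln (1 / (2 * alpha * (1 - beta))).

Definition delta7 (R : realType) (alpha beta : R) : R :=
  1 + delta4 alpha beta * delta6 alpha beta + delta5 alpha beta.

Definition delta8 (R : realType) (alpha beta : R) : R :=
  2 + 2 * delta4 alpha beta * delta6 alpha beta + 2 * delta5 alpha beta
  + (2 * delta2 alpha - 1 / 16 - ln (delta2 alpha))
    / (2 * delta2 alpha - 17 / 16).

(* Main.v *)
(** Work in the metric of the Hessian at the minimizer.  Self-concordance makes all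
    Hessians on the sublevel set of [x t] comparable with that one up to the factor
    [1 + D t], so that the iterates behave as for a quadratic up to errors [O(D t)].

    The decrease ratio [a t = 1 - C (t+1) / C t] factors as [p q n * cos^2 theta / m],
    where [p], [q], [n] come from the line search and gradient domination.  One BFGS
    update increases [Psi] by at most [D t + ln (cos^2 theta / m)], hence
    [- ln (a t) <= Psi_t - Psi_(t+1) + D t - ln (p q n)].  Always [p q n] is at least
    [2 alpha (1 - beta) / (1 + D t)]; this yields linear convergence, with the metric
    rescaled by [1 + D 0], and therefore a bound on the sum of the [D t].

    Moreover [Psi] drops by at least [omega (rho t - 1) - 2 D t], where
    [rho = p^T B p / p^T H p] compares [B] with the Hessian along the search direction
    [p].  So [rho t] lies outside [[delta2, delta3]] only boundedly often, and when it
    lies inside and [D t] is small the unit step is accepted and [- ln (p q n)] is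
    [O(omega (rho t - 1) + D t)].  Summing the [- ln (a t)], using
    [C (t+1) / C t <= - ln (a t)] and the AM-GM inequality gives the superlinear rate. *)
Require Import Defs.
From mathcomp Require Import all_boot all_order all_algebra.
From mathcomp Require Import all_classical all_reals all_analysis.
From mathcomp Require Import complex ring lra.
Set Implicit Arguments.
Unset Strict Implicit.
Unset Printing Implicit Defensive.
Import Order.TTheory GRing.Theory Num.Theory.
Import numFieldNormedType.Exports.
Local Open Scope ring_scope.

(** * Dot products and positive definite matrices *)

Section Dot.
Variables (R : realType) (d : nat).
Implicit Types (u v w : 'cV[R]_d) (A B : 'M[R]_d) (a : R).

Lemma dotE u v : dot u v = \sum_i u i 0 * v i 0.
Proof. by rewrite /dot mxE; apply: eq_bigr => i _; rewrite mxE. Qed.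

Lemma dotC u v : dot u v = dot v u.
Proof. by rewrite !dotE; apply: eq_bigr => i _; rewrite mulrC. Qed.

Lemma dotDr u v w : dot u (v + w) = dot u v + dot u w.
Proof. by rewrite /dot mulmxDr mxE. Qed.

Lemma dotDl u v w : dot (u + v) w = dot u w + dot v w.
Proof. by rewrite dotC dotDr !(dotC w). Qed.

Lemma dotZr a u v : dot u (a *: v) = a * dot u v.
Proof. by rewrite /dot -scalemxAr mxE. Qed.

Lemma dotZl a u v : dot (a *: u) v = a * dot u v.
Proof. by rewrite dotC dotZr dotC. Qed.

Lemma dotNr u v : dot u (- v) = - dot u v.
Proof. by rewrite -scaleN1r dotZr mulN1r. Qed.

Lemma dotNl u v : dot (- u) v = - dot u v.
Proof. by rewrite dotC dotNr dotC. Qed.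

Lemma dotBr u v w : dot u (v - w) = dot u v - dot u w.
Proof. by rewrite dotDr dotNr. Qed.

Lemma dotBl u v w : dot (u - v) w = dot u w - dot v w.
Proof. by rewrite dotDl dotNl. Qed.

Lemma dot0r u : dot u 0 = 0.
Proof. by rewrite /dot mulmx0 mxE. Qed.

Lemma dot0l u : dot 0 u = 0.
Proof. by rewrite dotC dot0r. Qed.

Lemma dot_mulmxl A u v : dot (A *m u) v = dot u (A^T *m v).
Proof. by rewrite /dot trmx_mul mulmxA. Qed.

Lemma dot_ge0 u : 0 <= dot u u.
Proof. by rewrite dotE sumr_ge0// => i _; rewrite -expr2 sqr_ge0. Qed.

Lemma dot_eq0 u : (dot u u == 0) = (u == 0).
Proof.
apply/idP/eqP => [|->]; last by rewrite dot0r.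
rewrite dotE psumr_eq0 => [/allP h|i _]; last by rewrite -expr2 sqr_ge0.
apply/matrixP => i j; rewrite ord1 mxE.
by have := h i (mem_index_enum _); rewrite /= -expr2 sqrf_eq0 => /eqP.
Qed.

Lemma dot_gt0 u : u != 0 -> 0 < dot u u.
Proof. by move=> u0; rewrite lt_def dot_eq0 u0 dot_ge0. Qed.

Lemma trmx_mul_dot u v : u^T *m v = (dot u v)%:M.
Proof. exact: mx11_scalar. Qed.

Lemma mxtrace_rank1 u v : \tr (u *m v^T) = dot u v.
Proof. by rewrite mxtrace_mulC trmx_mul_dot dotC mxtrace_scalar mulr1n. Qed.

Lemma posdefmx_quad_ge0 A u : posdefmx A -> 0 <= dot u (A *m u).
Proof.
move=> [_ hA]; have [->|/hA/ltW//] := eqVneq u 0.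
by rewrite mulmx0 dot0r.
Qed.

Lemma posdefmx_unit A : posdefmx A -> A \in unitmx.
Proof.
move=> [sA hA]; rewrite -row_free_unit -kermx_eq0.
apply/eqP/row_matrixP => i; rewrite row0.
set w := row i _; apply/eqP; apply: contraT => w0.
have wA : w *m A = 0 by rewrite /w -row_mul mulmx_ker row0.
have := hA w^T; rewrite -trmx0 (inj_eq trmx_inj) => /(_ w0).
by rewrite /dot trmxK mulmxA wA mul0mx mxE ltxx.
Qed.

Lemma posdefmx_congr A (T : 'M[R]_d) :
  posdefmx A -> T \in unitmx -> posdefmx (T^T *m A *m T).
Proof.
move=> [sA hA] uT; split; first by rewrite !trmx_mul trmxK sA mulmxA.
move=> u u0; rewrite -!mulmxA -{1}(trmxK T) -dot_mulmxl trmxK.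
by apply: hA; apply: contra u0 => /eqP Tu; rewrite -(mulKmx uT u) Tu mulmx0.
Qed.

Lemma posdefmxZ A a : 0 < a -> posdefmx A -> posdefmx (a *: A).
Proof.
move=> a0 [sA hA]; split; first by rewrite linearZ/= sA.
by move=> u u0; rewrite -scalemxAl dotZr mulr_gt0 ?hA.
Qed.

(** The quadratic [a + 2 t b + t^2 c] is nonnegative in [t]: evaluate it at its minimum [- b / c],
    or, if [c = 0] and [b] is nonzero, where it would equal [- a - 2]. *)
Lemma psd_cauchy_schwarz A u v : A^T = A ->
    (forall w, 0 <= dot w (A *m w)) ->
  dot u (A *m v) ^+ 2 <= dot u (A *m u) * dot v (A *m v).
Proof.
move=> sA hA; set b := dot u _; set a := dot u _; set c := dot v _.
have q t : 0 <= a + t * b *+ 2 + t ^+ 2 * c.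
  have := hA (u + t *: v); rewrite mulmxDr -scalemxAr !(dotDl, dotDr, dotZl, dotZr).
  have -> : dot v (A *m u) = b by rewrite dotC dot_mulmxl sA.
  by rewrite -/a -/b -/c; lra.
have a0 : 0 <= a := hA u.
have [c0|c0] := leP c 0.
  have /eqP cE : c == 0 by rewrite eq_le c0 hA.
  have [->|b0] := eqVneq b 0; first by rewrite cE mulr0 expr0n.
  have := q (- (a + 1) / b); rewrite cE mulr0 addr0 divfK//; lra.
have := q (- b / c).
have -> : a + - b / c * b *+ 2 + (- b / c) ^+ 2 * c = (a * c - b ^+ 2) / c.
  by field; rewrite gt_eqF.
by rewrite pmulr_lge0 ?invr_gt0// subr_ge0.
Qed.

Lemma cauchy_schwarz u v : dot u v ^+ 2 <= dot u u * dot v v.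
Proof.
have := @psd_cauchy_schwarz 1%:M u v; rewrite !mul1mx; apply.
  by rewrite trmx1.
by move=> w; rewrite mul1mx dot_ge0.
Qed.

End Dot.

(** * Determinants and nonnegativity of [Psi] *)

Section Determinant.
Variable R : realType.

(** Compare the determinants of two block triangular factorizations of [X]. *)
Lemma det_1Drank1 (d : nat) (u v : 'cV[R]_d) : \det (1%:M + u *m v^T) = 1 + dot v u.
Proof.
pose X := block_mx (1%:M : 'M[R]_1) (- v^T) u (1%:M : 'M[R]_d).
have X1 : X = block_mx 1%:M 0 u 1%:M *m block_mx 1%:M (- v^T) 0 (1%:M + u *m v^T).
  rewrite mulmx_block !mul1mx !mul0mx !mulmx1 !addr0.
  by rewrite mulmxN addrCA addNr addr0.
have X2 : X = block_mx (1 + dot v u)%:M (- v^T) 0 1%:M *m block_mx 1%:M 0 u 1%:M.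
  rewrite mulmx_block !mulmx1 !mulmx0 !mul1mx !add0r ?mul0mx ?add0r.
  by rewrite mulNmx trmx_mul_dot raddfD addrK.
have := congr1 (fun Y => \det Y) X1.
rewrite X2 !det_mulmx !det_ublock !det_lblock !det1 !mulr1 !mul1r => <-.
by rewrite det_scalar1.
Qed.

(** Induction on the dimension through the Schur complement [S] of the corner entry [a]: the
    determinant is [a * \det S], the trace is [a + \tr S] plus a nonnegative term, and
    [ln a <= a - 1]. Both claims go together because splitting the logarithm needs [\det S]
    positive. *)
Lemma Psi_ge0_det_gt0 (d : nat) (A : 'M[R]_d) :
  posdefmx A -> 0 < \det A /\ 0 <= Psi A.
Proof.
elim: d A => [A _|d IH A hA].
  by rewrite /Psi det_mx00 ln1 /mxtrace big_ord0 !subr0.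
have [sA pA] := hA.
pose A' : 'M[R]_(1 + d) := A.
pose a := ulsubmx A' 0 0; pose b := dlsubmx A'; pose C := drsubmx A'.
have pA' (w : 'cV_(1 + d)) : w != 0 -> 0 < dot w (A' *m w) := pA w.
have ulE : ulsubmx A' = a%:M by rewrite [LHS]mx11_scalar.
have urE : ursubmx A' = b^T by rewrite /b trmx_dlsub sA.
have sC : C^T = C by rewrite /C trmx_drsub sA.
have AE : A' = block_mx a%:M b^T b C by rewrite -ulE -urE submxK.
have a0 : 0 < a.
  have := pA' (@col_mx _ 1 d 1 1%:M 0).
  have -> : dot (@col_mx _ 1 d 1 1%:M 0) (A' *m (@col_mx _ 1 d 1 1%:M 0)) = a.
    rewrite AE /dot mul_block_col tr_col_mx mul_row_col.
    by rewrite !mulmx0 trmx0 mul0mx !addr0 trmx1 mul1mx mulmx1 mxE eqxx.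
  apply; apply/eqP => /(congr1 (fun X : 'cV_(1 + d) => usubmx X 0 0)).
  by rewrite col_mxKu !mxE => /eqP; rewrite oner_eq0.
pose S := C - a^-1 *: (b *m b^T).
have LU : A' = block_mx 1%:M 0 (a^-1 *: b) 1%:M *m block_mx a%:M b^T 0 S.
  rewrite AE mulmx_block !mul1mx !mul0mx !addr0 -!scalemxAl.
  by rewrite mul_mx_scalar scalerA mulVf ?gt_eqF// scale1r addrC subrK.
have pS : posdefmx S.
  split; first by rewrite /S linearB linearZ/= trmx_mul trmxK sC.
  move=> u u0; set r := a^-1 * dot b u.
  have := pA' (@col_mx _ 1 d 1 (- r)%:M u).
  have -> : dot (@col_mx _ 1 d 1 (- r)%:M u) (A' *m (@col_mx _ 1 d 1 (- r)%:M u))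
     = dot u (S *m u).
    rewrite AE /dot mul_block_col tr_col_mx mul_row_col.
    rewrite (trmx_mul_dot b) tr_scalar_mx !mul_scalar_mx mul_mx_scalar mxE.
    change ((- r *: (a *: (- r)%:M + (dot b u)%:M) : 'M[R]_1) 0 0 + dot u (- r *: b + C *m u)
      = dot u (S *m u) :> R).
    rewrite dotDr dotZr !mxE eqxx !mulr1n /S mulmxBl -scalemxAl -mulmxA.
    rewrite trmx_mul_dot mul_mx_scalar dotBr !dotZr /r (dotC u b).
    by field; rewrite gt_eqF.
  apply; apply: contra u0 => /eqP/(congr1 (fun X : 'cV_(1 + d) => dsubmx X)).
  by rewrite col_mxKd => ->; apply/eqP/matrixP => i j; rewrite !mxE.
have [dS0 PS0] := IH S pS.
have detE : \det A = a * \det S.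
  suff : \det A' = a * \det S by [].
  by rewrite LU det_mulmx det_lblock det_ublock !det1 !mul1r det_scalar1.
split; first by rewrite detE mulr_gt0.
have trE : \tr A = a + \tr S + a^-1 * dot b b.
  suff : \tr A' = a + \tr S + a^-1 * dot b b by [].
  rewrite AE mxtrace_block mxtrace_scalar mulr1n /S linearB linearZ/=.
  by rewrite mxtrace_rank1; lra.
move: PS0; rewrite /Psi detE trE lnM ?posrE//.
have : ln a <= a - 1.
  by have := @le_ln1Dx R (a - 1); rewrite [1 + _]addrC subrK; apply; lra.
have : 0 <= a^-1 * dot b b by rewrite mulr_ge0 ?dot_ge0// invr_ge0 ltW.
by rewrite -natr1; lra.
Qed.

Lemma posdefmx_det_gt0 (d : nat) (A : 'M[R]_d) : posdefmx A -> 0 < \det A.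
Proof. by case/Psi_ge0_det_gt0. Qed.

Lemma Psi_ge0 (d : nat) (A : 'M[R]_d) : posdefmx A -> 0 <= Psi A.
Proof. by case/Psi_ge0_det_gt0. Qed.

End Determinant.

(** * The BFGS update and its effect on [Psi] *)

Section Update.
Variables (R : realType) (d : nat).
Implicit Types (s y : 'cV[R]_d) (A S : 'M[R]_d).

(* The update is the congruence J A J^T by a rank-one perturbation J of the identity. *)
Lemma bfgs_update_congr A s y : posdefmx A -> s != 0 -> 0 < dot s y ->
  exists J : 'M[R]_d, [/\ J \in unitmx, bfgs_update A s y = J *m A *m J^T &
    \det J ^+ 2 = dot s y / dot s (A *m s)].
Proof.
move=> pA s0 sy0; have [sA /(_ _ s0)] := pA.
set sig := dot s (A *m s) => sig0.
(* For [J = 1 + u s^T] this scaling gives [J A s = th y] and [J^T s = (th * dot s y / sig) s], hence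
   [J A J^T s = y]. *)
pose th := Num.sqrt (sig / dot s y).
have th2 : th ^+ 2 = sig / dot s y by rewrite sqr_sqrtr// divr_ge0 ?ltW.
pose u := sig^-1 *: (th *: y - A *m s).
have detJ : \det (1%:M + u *m s^T) = th * dot s y / sig.
  rewrite det_1Drank1 /u dotZr dotBr dotZr -/sig.
  by field; rewrite gt_eqF.
have detJ2 : \det (1%:M + u *m s^T) ^+ 2 = dot s y / sig.
  rewrite detJ !exprMn th2; field; rewrite !gt_eqF//.
exists (1%:M + u *m s^T); split => //.
  by rewrite unitmxE unitfE -sqrf_eq0 detJ2 gt_eqF// divr_gt0.
rewrite linearD/= trmx1 trmx_mul trmxK mulmxDl mul1mx mulmxDr mulmx1 mulmxDl.
have -> : A *m (s *m u^T) = (A *m s) *m u^T by rewrite mulmxA.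
have -> : u *m s^T *m A = u *m (A *m s)^T by rewrite trmx_mul sA mulmxA.
have -> : u *m (A *m s)^T *m (s *m u^T) = sig *: (u *m u^T).
  rewrite mulmxA -(mulmxA u) trmx_mul_dot -(mulmxA u) mul_scalar_mx dotC -scalemxAr//.
rewrite /bfgs_update -/sig.
have -> : A *m s *m s^T *m A = (A *m s) *m (A *m s)^T.
  by rewrite trmx_mul sA mulmxA.
set z := A *m s; rewrite -!addrA; congr (_ + _).
have -> : (dot s y)^-1 = sig^-1 * th ^+ 2.
  by rewrite th2; field; rewrite !gt_eqF.
apply/matrixP => i j; rewrite !mxE !big_ord1 !mxE.
by field; rewrite gt_eqF.
Qed.

Lemma posdefmx_bfgs_update A s y : posdefmx A -> s != 0 -> 0 < dot s y ->
  posdefmx (bfgs_update A s y).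
Proof.
move=> pA s0 sy0; have [J [uJ -> _]] := bfgs_update_congr pA s0 sy0.
by rewrite -{1}(trmxK J); apply: posdefmx_congr; rewrite ?unitmx_tr.
Qed.

(** The determinant is multiplied by [\det J ^+ 2]; the trace changes by those of the two rank-one
    terms. All potential estimates of the run are read off this identity. *)
Lemma Psi_bfgs_update A s y : posdefmx A -> s != 0 -> 0 < dot s y ->
  Psi (bfgs_update A s y) =
  Psi A - dot (A *m s) (A *m s) / dot s (A *m s) + dot y y / dot s y
  - ln (dot s y / dot s (A *m s)).
Proof.
move=> pA s0 sy0; have [sA /(_ _ s0) sig0] := pA.
have [J [uJ JE dJ]] := bfgs_update_congr pA s0 sy0.
have detE : \det (bfgs_update A s y) = \det A * (dot s y / dot s (A *m s)).
  by rewrite JE !det_mulmx det_tr -dJ; ring.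
rewrite /Psi detE (@lnM _ (\det A)) ?posrE ?posdefmx_det_gt0 ?divr_gt0//.
have -> : \tr (bfgs_update A s y) =
  \tr A - dot (A *m s) (A *m s) / dot s (A *m s) + dot y y / dot s y.
  have E : A *m s *m s^T *m A = (A *m s) *m (A *m s)^T.
    by rewrite trmx_mul sA mulmxA.
  by rewrite /bfgs_update E raddfD raddfB/= !mxtraceZ !mxtrace_rank1; ring.
ring.
Qed.

Lemma bfgs_updateZ (c : R) A s y : c != 0 ->
  bfgs_update (c *: A) s (c *: y) = c *: bfgs_update A s y.
Proof.
move=> c0; have yT : (c *: y)^T = c *: y^T by rewrite linearZ.
rewrite /bfgs_update yT -!scalemxAl -!scalemxAr !dotZr scalerDr scalerBr !scalerA.
by congr (_ - _ *: _ + _ *: _); rewrite invfM [c^-1 * _]mulrC mulfVK// mulrC.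
Qed.

(** Steps transform by [S] and gradient differences by its inverse, so all pairings are preserved
    and the run can be studied in the metric of the Hessian at the minimizer. *)
Lemma bfgs_update_change_of_basis S A s y : S \in unitmx -> S^T = S ->
  invmx S *m bfgs_update A s y *m invmx S =
  bfgs_update (invmx S *m A *m invmx S) (S *m s) (invmx S *m y).
Proof.
move=> uS sS; have sSi : (invmx S)^T = invmx S by rewrite trmx_inv sS.
have E1 : invmx S *m A *m invmx S *m (S *m s) = invmx S *m (A *m s).
  by rewrite -!mulmxA mulKmx// mulmxA.
rewrite /bfgs_update E1.
have -> : dot (S *m s) (invmx S *m (A *m s)) = dot s (A *m s).
  by rewrite dot_mulmxl sS mulKVmx.
have -> : dot (S *m s) (invmx S *m y) = dot s y by rewrite dot_mulmxl sS mulKVmx.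
rewrite mulmxDr mulmxDl mulmxBr mulmxBl -!scalemxAr -!scalemxAl !trmx_mul sS sSi.
by rewrite !mulmxA mulmxK.
Qed.

End Update.

(** * Positive definite square roots *)

Section SquareRoot.
Variable R : realType.

(** The spectral theorem is applied over the complex numbers. The spectrum is real, and real
    matrices similar over the complex numbers are similar over the reals; this yields an invertible
    [P], with no claim of orthogonality. *)
Lemma symmetric_diagonalizable (n : nat) (A : 'M[R]_n) : A^T = A ->
  exists P : 'M[R]_n, exists l : 'rV[R]_n,
    P \in unitmx /\ P *m A = diag_mx l *m P.
Proof.
move=> sA; pose toC := real_complex R.
have realC m k (X : 'M[R]_(m, k)) : map_mx toC X \is a realmx.
  by apply/mxOverP => i j; rewrite mxE complex_real.
have toCK m k (X : 'M[R[i]]_(m, k)) : X \is a realmx ->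
    map_mx toC (map_mx (@complex.Re R) X) = X.
  by move=> /mxOverP rX; apply/matrixP => i j; rewrite !mxE; apply: RRe_real.
pose AC := map_mx toC A.
have hAC : AC \is hermsymmx.
  apply: realsym_hermsym; last exact: realC.
  rewrite is_hermitianmxE expr0 scale1r.
  by rewrite eq_map_mx_id// map_trmx sA.
have rl := hermitian_spectral_diag_real hAC.
have /orthomx_spectralP AE := hermitian_normalmx hAC.
have sim : similar_in unitmx AC (diag_mx (spectral_diag AC)).
  exists (spectralmx AC); first exact: spectral_unit.
  by apply/(similarP (spectral_unit _)); rewrite {2}AE -mulmxA mulKVmx ?spectral_unit.
have rd : diag_mx (spectral_diag AC) \is a realmx.
  apply/mxOverP => i j; rewrite mxE; case: eqP => _; rewrite ?mulr0n ?mulr1n ?real0//.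
  exact: (mxOverP rl).
have [P /andP[rP uP]] := real_similar sim (realC _ _ A) rd.
move=> /(similarP uP) PA.
exists (map_mx (@complex.Re R) P), (map_mx (@complex.Re R) (spectral_diag AC)).
split.
  rewrite -(map_unitmx (real_complex R)) toCK//.
apply: (@map_mx_inj _ _ (real_complex R)).
by rewrite !map_mxM map_diag_mx /= !toCK.
Qed.

(** As [P] is not known to be orthogonal, symmetry does not come from the diagonalization; the root
    is built instead from a polynomial [T] in [A], which is symmetric because [A] is. *)
Lemma posdefmx_sqrt_exists (n : nat) (A : 'M[R]_n) : posdefmx A ->
  exists S : 'M[R]_n, posdefmx S /\ S *m S = A.
Proof.
case: n A => [|n] A pA.
  exists 1%:M; split; last by apply/matrixP => -[].
  split; first by rewrite trmx1.
  by move=> u; rewrite (flatmx0 u) eqxx.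
have [sA hA] := pA.
have [P [l [uP PA]]] := symmetric_diagonalizable sA.
have l0 i : 0 < l 0 i.
  have r0 : row i P != 0.
    apply/eqP => r0; have := mulmxK uP (delta_mx 0 i : 'rV[R]_n.+1).
    rewrite -rowE r0 mul0mx => /matrixP/(_ 0 i)/eqP.
    by rewrite !mxE !eqxx eq_sym oner_eq0.
  have := hA (row i P)^T; rewrite -trmx0 (inj_eq trmx_inj) => /(_ r0).
  rewrite /dot trmxK mulmxA -row_mul PA row_mul row_diag_mx -scalemxAl -rowE -scalemxAl mxE.
  rewrite pmulr_lgt0//.
  have := @dot_gt0 R _ (row i P)^T; rewrite /dot trmxK; apply.
  by rewrite -trmx0 (inj_eq trmx_inj).
(* Fourth roots: the square of a symmetric matrix is automatically semidefinite. *)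
pose g x : R := Num.sqrt (Num.sqrt x).
have g4 x : 0 <= x -> g x ^+ 4 = x.
  by move=> x0; rewrite (exprM _ 2 2) !sqr_sqrtr ?sqrtr_ge0.
(* Newton interpolation, one eigenvalue at a time; [undup] keeps the nodes distinct, so that [w]
   does not vanish at the new node. *)
have [q qE] : exists q : {poly R}, forall i, q.[l 0 i] = g (l 0 i).
  pose s := undup [seq l 0 i | i <- enum 'I_n.+1].
  suff [q qE] : exists q : {poly R}, forall x, x \in s -> q.[x] = g x.
    exists q => i; apply: qE; rewrite mem_undup; apply/mapP.
    by exists i => //; rewrite mem_enum.
  have := undup_uniq [seq l 0 i | i <- enum 'I_n.+1]; rewrite -/s.
  elim: s => [|x s IH]; first by exists 0.
  move=> /= /andP[xs us]; have [q qE] := IH us.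
  pose w := \prod_(z <- s) ('X - z%:P).
  have wx : w.[x] != 0.
    by move: xs; rewrite -root_prod_XsubC.
  exists (q + ((g x - q.[x]) / w.[x]) *: w) => z.
  rewrite inE => /orP[/eqP->|zs].
    by rewrite !hornerE divfK// addrC subrK.
  have /eqP wz : root w z by rewrite root_prod_XsubC.
  by rewrite !hornerE wz mulr0 addr0 qE.
have AE : A = invmx P *m diag_mx l *m P by rewrite -mulmxA -PA mulKmx.
pose T := horner_mx A q.
have sT : T^T = T.
  rewrite /T; elim/poly_ind: (q) => [|p c IH]; first by rewrite !rmorph0 trmx0.
  rewrite !rmorphD !rmorphM /= horner_mx_X horner_mx_C linearD/= tr_scalar_mx.
  rewrite trmx_mul sA IH.
  by rewrite (@comm_mx_horner _ _ A A p erefl).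
have T4 : (T *m T) *m (T *m T) = A.
  have lE : map_mx (horner (q ^+ 4)) l = l.
    by apply/rowP => i; rewrite mxE horner_exp qE g4 ?ltW.
  rewrite -[LHS]/(T * T * (T * T)) -expr2 -expr2 -exprM.
  by rewrite /T -rmorphXn/= {1}AE horner_mx_uconjC// horner_mx_diag lE.
exists (T *m T); split; last exact: T4.
split; first by rewrite trmx_mul sT.
move=> u u0; rewrite -mulmxA -{1}sT -dot_mulmxl.
apply: dot_gt0; apply: contra u0 => /eqP Tu.
rewrite -(mulKmx (posdefmx_unit pA) u) -T4.
by rewrite -!mulmxA Tu !mulmx0.
Qed.

Lemma sqrtmxP (n : nat) (A : 'M[R]_n) : posdefmx A ->
  posdefmx (sqrtmx A) /\ sqrtmx A *m sqrtmx A = A.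
Proof.
move=> /posdefmx_sqrt_exists[S hS].
exact: (@xgetPex _ 0 [set S | posdefmx S /\ S *m S = A]%classic (ex_intro _ S hS)).
Qed.

End SquareRoot.

(** * One-variable calculus: [ln], [omega] and its inverse *)

Section RealFunctions.
Local Open Scope classical_set_scope.
Local Open Scope ring_scope.
Variable R : realType.
Implicit Types (x y a b c : R).

Lemma is_derive_continuous_itv (h dh : R -> R) a b :
  (forall t, a <= t <= b -> is_derive t 1 h (dh t)) ->
  {within `[a, b], continuous h}.
Proof.
move=> dH; apply: derivable_within_continuous => t; rewrite in_itv/= => tab.
by have [] := dH t tab.
Qed.

Lemma ler_increment (h k dh dk : R -> R) a b : a <= b ->
  (forall t, a <= t <= b -> is_derive t 1 h (dh t)) ->
  (forall t, a <= t <= b -> is_derive t 1 k (dk t)) ->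
  (forall t, a <= t <= b -> dk t <= dh t) ->
  k b - k a <= h b - h a.
Proof.
move=> ab dH dK le.
have dhk t : a <= t <= b -> is_derive t 1 (h \- k) (dh t - dk t).
  by move=> tab; have := dH t tab; have := dK t tab => ? ?; exact: is_deriveB.
have [||t tab E] := @MVT_segment R (h \- k) (fun t => dh t - dk t) a b ab.
- by move=> t; rewrite in_itv/= => /andP[at_ tb]; apply: dhk; rewrite !ltW.
- exact: is_derive_continuous_itv dhk.
have : 0 <= (dh t - dk t) * (b - a).
  by rewrite mulr_ge0 ?subr_ge0// le//; move: tab; rewrite in_itv.
by rewrite -E /=; lra.
Qed.

(** Used to turn bounds on the Hessian along a segment into bounds on [f]. *)
Lemma ler_increment2 (h k h' k' h'' k'' : R -> R) b : 0 <= b ->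
  (forall t, 0 <= t <= b -> is_derive t 1 h (h' t)) ->
  (forall t, 0 <= t <= b -> is_derive t 1 k (k' t)) ->
  (forall t, 0 <= t <= b -> is_derive t 1 h' (h'' t)) ->
  (forall t, 0 <= t <= b -> is_derive t 1 k' (k'' t)) ->
  (forall t, 0 <= t <= b -> k'' t <= h'' t) ->
  k' 0 <= h' 0 -> k b - k 0 <= h b - h 0.
Proof.
move=> b0 dh dk dh' dk' le le0; apply: (ler_increment b0 dh dk) => t /andP[t0 tb].
have sub u : 0 <= u <= t -> 0 <= u <= b by move=> /andP[-> /le_trans ->].
have := @ler_increment h' k' h'' k'' 0 t t0
  (fun u hu => dh' u (sub u hu)) (fun u hu => dk' u (sub u hu))
  (fun u hu => le u (sub u hu)).
lra.
Qed.

Lemma ln_ge_1V x : 0 < x -> 1 - x^-1 <= ln x.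
Proof.
move=> x0; have xV : 0 < x^-1 by rewrite invr_gt0.
have := @le_ln1Dx R (x^-1 - 1); rewrite [1 + _]addrC subrK lnV ?posrE//.
by move=> H; have := H ltac:(lra); lra.
Qed.

Lemma ln_le_sub1 x : 0 < x -> ln x <= x - 1.
Proof. by move=> x0; have := @le_ln1Dx R (x - 1); rewrite [1 + _]addrC subrK; apply; lra. Qed.

Lemma is_derive_ln1D x : -1 < x -> is_derive x 1 (fun t => ln (1 + t)) (1 + x)^-1.
Proof.
move=> x1; have h : 0 < 1 + x by lra.
have /(@is_derive1_ln R) d1 := h.
have d2 : is_derive x 1 (fun t : R => 1 + t) 1.
  by rewrite -[X in is_derive _ _ _ X]add0r; apply: is_deriveD.
by have := @is_derive1_comp R _ _ x _ _ d1 d2; rewrite mulr1.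
Qed.

Lemma is_derive_omega x : -1 < x -> is_derive x 1 (@omega R) (x / (1 + x)).
Proof.
move=> x1; have d := is_derive_ln1D x1.
have -> : x / (1 + x) = 1 - (1 + x)^-1 by field; apply/eqP; lra.
exact: is_deriveB.
Qed.

Lemma is_derive_sqr_half x : is_derive x 1 (fun t : R => t ^+ 2 / 2) x.
Proof.
have d : is_derive x 1 (fun t : R => t ^+ 2) (2 * x).
  by apply: is_derive_eq; rewrite [_ *: _]mulr1 mulr_natl.
have -> : (fun t : R => t ^+ 2 / 2) = (fun t => 2^-1 *: (t ^+ 2 : R)).
  by apply/funext => t; rewrite mulrC.
by apply: is_derive_eq; rewrite [_ *: _]mulrA mulVf ?mul1r// pnatr_eq0.
Qed.

Lemma omega0 : omega (0 : R) = 0.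
Proof. by rewrite /omega addr0 ln1 subr0. Qed.

Lemma omega_mono x y : 0 <= x -> x <= y -> omega x <= omega y.
Proof.
move=> x0 xy.
have := @ler_increment (@omega R) (cst 0) (fun t => t / (1 + t)) (cst 0) x y xy.
rewrite /= subrr subr_ge0; apply => t /andP[xt ty].
- by apply: is_derive_omega; lra.
- by rewrite divr_ge0//; lra.
Qed.

Lemma omega_anti x y : -1 < x -> x <= y -> y <= 0 -> omega y <= omega x.
Proof.
move=> x1 xy y0.
have := @ler_increment (cst 0) (@omega R) (cst 0) (fun t => t / (1 + t)) x y xy.
rewrite /= subrr subr_le0; apply => t /andP[xt ty].
- by apply: is_derive_omega; lra.
- by rewrite /= -oppr_ge0 -mulNr divr_ge0//; lra.
Qed.

Lemma omega_ge0 x : -1 < x -> 0 <= omega x.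
Proof.
by move=> x1; rewrite /omega subr_ge0; exact: le_ln1Dx.
Qed.

Lemma omega_le_sqr x : -1 < x -> omega x <= x ^+ 2 / (1 + x).
Proof.
move=> x1; have := @ln_ge_1V (1 + x) ltac:(lra); rewrite /omega.
have -> : x ^+ 2 / (1 + x) = x - (1 - (1 + x)^-1) by field; apply/eqP; lra.
lra.
Qed.

Lemma omega_ge_sqr_neg x : -1 < x -> x <= 0 -> x ^+ 2 / 2 <= omega x.
Proof.
move=> x1 x0.
have := @ler_increment (fun t : R => t ^+ 2 / 2) (@omega R) id (fun t => t / (1 + t)) x 0 x0.
rewrite omega0 expr0n/= mul0r !sub0r lerN2; apply => t /andP[xt t0].
- exact: is_derive_sqr_half.
- by apply: is_derive_omega; lra.
- rewrite ler_pdivrMr; last lra.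
  by rewrite mulrDr mulr1 lerDl -expr2 sqr_ge0.
Qed.

Lemma is_derive_V1D a x : 0 < a + x ->
  is_derive x 1 (fun t : R => (a + t)^-1) (- (a + x) ^- 2).
Proof.
move=> ax; have d2 : is_derive x 1 (fun t : R => a + t) 1.
  by rewrite -[X in is_derive _ _ _ X]add0r; apply: is_deriveD.
have := @is_deriveV R (fun t => a + t) x 1 1 (lt0r_neq0 ax) d2.
by rewrite scaler1.
Qed.

Lemma omega_ge_sqr_pos x : 0 <= x -> x ^+ 2 / (2 * (1 + x)) <= omega x.
Proof.
move=> x0.
have -> : x ^+ 2 / (2 * (1 + x)) = 2^-1 * (x - 1 + (1 + x)^-1).
  by field; apply/eqP; lra.
have := @ler_increment (@omega R) (fun t => 2^-1 *: (t - 1 + (1 + t)^-1 : R))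
  (fun t => t / (1 + t)) (fun t => 2^-1 * (1 - (1 + t)^-2)) 0 x x0.
rewrite omega0 !addr0 invr1 subr0 add0r [-1 + 1]addrC subrr scaler0 !subr0.
apply => t /andP[t0 tx].
- by apply: is_derive_omega; lra.
- have d := @is_derive_V1D 1 t ltac:(lra).
  apply: is_derive_eq.
  by rewrite subr0.
- have h : 0 < 1 + t by lra.
  rewrite -subr_ge0.
  have -> : t / (1 + t) - 2^-1 * (1 - (1 + t) ^- 2) = t ^+ 2 / (2 * (1 + t) ^+ 2).
    by field; rewrite gt_eqF.
  by rewrite divr_ge0 ?sqr_ge0// mulr_ge0 ?sqr_ge0//.
Qed.

(** The derivatives in [x] compare because [th * x <= x]. Through this bound a contraction of the
    gap by [th ^+ 2] becomes a contraction of [D] by [th]. *)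
Lemma omega_scale th x : 0 <= th -> th <= 1 -> 0 <= x ->
  th ^+ 2 * omega x <= omega (th * x).
Proof.
move=> t0 t1 x0.
have dl t : 0 <= t <= x -> is_derive t 1 (fun t => omega (th * t)) (th * (th * t / (1 + th * t))).
  move=> /andP[h0 h1].
  have d1 : is_derive (th * t) 1 (@omega R) (th * t / (1 + th * t)).
    by apply: is_derive_omega; have := mulr_ge0 t0 h0; lra.
  have d2 : is_derive t 1 (fun t => th * t) th.
    have := @is_deriveZ R R^o R^o id th t 1 1 (is_derive_id t 1).
    by rewrite [_ *: 1]mulr1.
  by have := @is_derive1_comp R _ _ t _ _ d1 d2; rewrite mulrC.
have := @ler_increment (fun t => omega (th * t)) (fun t => th ^+ 2 *: (omega t : R^o))
  (fun t => th * (th * t / (1 + th * t))) (fun t => th ^+ 2 * (t / (1 + t))) 0 x x0 dl.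
rewrite mulr0 omega0 scaler0 !subr0; apply => t /andP[h0 h1].
  have d := @is_derive_omega t ltac:(lra).
  exact: is_deriveZ.
have h2 : 0 <= th * t by rewrite mulr_ge0.
have h3 : th * t <= t by rewrite ler_piMl.
rewrite -subr_ge0.
have -> : th * (th * t / (1 + th * t)) - th ^+ 2 * (t / (1 + t)) =
  th ^+ 2 * t * (t - th * t) / ((1 + th * t) * (1 + t)).
  by field; apply/andP; split; apply/eqP; lra.
by rewrite divr_ge0 ?mulr_ge0 ?subr_ge0 ?sqr_ge0//; lra.
Qed.

Lemma omega_surj c : 0 <= c -> exists2 x, 0 <= x & omega x = c.
Proof.
(* Chosen so that the lower bound [b^2 / (2 (1 + b))] for [omega b] is at least [c]. *)
move=> c0; pose b := 2 * c + 2.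
have cb : c <= omega b.
  apply: le_trans (omega_ge_sqr_pos _); last by rewrite /b; lra.
  rewrite ler_pdivlMr /b; last lra.
  rewrite -subr_ge0.
  have -> : (2 * c + 2) ^+ 2 - c * (2 * (1 + (2 * c + 2))) = 2 * c + 4 by ring.
  lra.
have b0 : 0 <= b by rewrite /b; lra.
have cont : {within `[0, b], continuous (@omega R)}.
  apply: (@is_derive_continuous_itv _ (fun t => t / (1 + t))) => t /andP[t0 _].
  by apply: is_derive_omega; lra.
have [|x] := @IVT R (@omega R) 0 b c b0 cont.
  by rewrite omega0 min_l ?max_r ?c0//; apply: omega_ge0; lra.
by rewrite in_itv/= => /andP[x0 _] <-; exists x.
Qed.

(** Surjectivity of [omega] onto the nonnegative reals keeps the partial inverse away from its
    default value. *)
Lemma omega_invP c : 0 <= c -> 0 <= omega_inv c /\ omega (omega_inv c) = c.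
Proof.
move=> c0; pose A := [set x : R | 0 <= x]%classic.
have cA : c \in (@omega R @` A)%classic.
  by have [x x0 xc] := omega_surj c0; rewrite inE; exists x.
split; last exact: pinvK cA.
have sA : set_surj A [set y : R | 0 <= y]%classic (@omega R).
  by move=> y /= /omega_surj[x x0 <-]; exists x.
by apply: (surjpinv_image_sub (dflt := fun=> 0) sA); exists c.
Qed.

Lemma omega_lt x y : 0 <= x -> x < y -> omega x < omega y.
Proof.
move=> x0 xy; have [x_gt0|] := ltP 0 x; last first.
  move=> x_le0; have -> : x = 0 by lra.
  rewrite omega0; apply: lt_le_trans (omega_ge_sqr_pos _); last lra.
  by rewrite divr_gt0 ?exprn_gt0//; lra.
have [||t tab E] := @MVT_segment R (@omega R) (fun t => t / (1 + t)) x y (ltW xy).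
- by move=> t; rewrite in_itv/= => /andP[xt ty]; apply: is_derive_omega; lra.
- apply: (@is_derive_continuous_itv _ (fun t => t / (1 + t))) => t /andP[xt _].
  by apply: is_derive_omega; lra.
move: tab; rewrite in_itv/= => /andP[xt ty].
have : 0 < t / (1 + t) * (y - x).
  by rewrite mulr_gt0 ?divr_gt0//; lra.
lra.
Qed.

(* [ln (1 + x) >= 2 x / (2 + x)], which is [1 / 8] at [x = 2 / 15]. *)
Lemma expR1_le : expR 1 <= 137 / 50 :> R.
Proof.
have h : 1 / 8 <= ln (1 + 2 / 15 : R).
  have := @ler_increment (fun t : R => ln (1 + t)) (fun t => - 4 *: ((2 + t)^-1 : R))
    (fun t => (1 + t)^-1) (fun t => - 4 * - (2 + t) ^- 2) 0 (2 / 15) ltac:(lra).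
  rewrite !addr0 ln1 subr0 => H.
  apply: le_trans (H _ _ _); last first.
  - move=> t /andP[t0 t1]; have h1 : 0 < 1 + t by lra.
    have h2 : 0 < 2 + t by lra.
    rewrite -subr_ge0.
    have -> : (1 + t)^-1 - -4 * - (2 + t) ^- 2 = t ^+ 2 / ((1 + t) * (2 + t) ^+ 2).
      by field; rewrite !gt_eqF.
    by rewrite divr_ge0 ?sqr_ge0 ?mulr_ge0 ?sqr_ge0//; lra.
  - move=> t /andP[t0 t1]; have d := @is_derive_V1D 2 t ltac:(lra).
    exact: is_deriveZ.
  - by move=> t /andP[t0 t1]; apply: is_derive_ln1D; lra.
  - have -> : (2 + 2 / 15 : R)^-1 = 15 / 32 by field.
    by rewrite /GRing.scale/=; lra.
have h2 : expR (1 / 8) <= 1 + 2 / 15 :> R.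
  by rewrite -[leRHS]lnK ?posrE ?ler_expR//; lra.
have -> : expR 1 = ((expR (1 / 8) ^+ 2) ^+ 2) ^+ 2 :> R.
  by rewrite -!exprM -expRM_natl; congr expR; field.
have sq (a b c : R) : 0 <= a -> a <= b -> b * b <= c -> a ^+ 2 <= c.
  by move=> a0 ab; apply: le_trans; rewrite expr2 ler_pM.
(* The eighth power of [17 / 15] by three squarings, rounded up to [9 / 7], [43 / 26] and
   [137 / 50]. *)
apply: (sq _ (43 / 26)); rewrite ?exprn_ge0 ?expR_ge0//; last lra.
apply: (sq _ (9 / 7)); rewrite ?exprn_ge0 ?expR_ge0//; last lra.
by apply: (sq _ _ _ _ h2); rewrite ?expR_ge0//; lra.
Qed.

End RealFunctions.

(** * Derivatives of [f] and of its gradient along lines *)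

Section LineDerivatives.
Variables (R : realType) (d : nat).
Implicit Types (f : 'cV[R]_d -> R) (x v w : 'cV[R]_d).

Lemma diff_gradient f x v : differentiable f x -> 'd f x v = dot (gradient f x) v.
Proof.
move=> df; rewrite {1}(matrix_sum_delta v) linear_sum dotE; apply: eq_bigr => i _.
by rewrite big_ord1 linearZ/= mxE deriveE// mulrC.
Qed.

Lemma is_derive_line f x v (t : R) : differentiable f (x + t *: v) ->
  is_derive t 1 (fun t : R => f (x + t *: v)) (dot (gradient f (x + t *: v)) v).
Proof.
move=> df; pose g (t : R) := x + t *: v.
have dg : is_diff t g (fun s : R => s *: v).
  have h : is_diff t (cst x + (fun s : R => s *: v)) (0 + (fun s : R => s *: v)).
    by apply: is_diffD; exact: is_diff_scalel.
  by rewrite add0r in h.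
have dfg : differentiable (f \o g) t.
  by apply: differentiable_comp => //; case: dg.
apply: DeriveDef; first exact/derivable1_diffP.
have dfg' : differentiable g t by case: dg.
rewrite deriveE// diff_comp//=.
by rewrite (@diff_val _ _ _ _ _ _ _ dg) scale1r diff_gradient.
Qed.

(** A chain rule for each component of the gradient. It produces the entries of the Hessian in
    transposed order, hence the symmetry hypothesis, which positive definiteness supplies later. *)
Lemma is_derive_gradient_line f x v w (t : R) :
    differentiable (gradient f) (x + t *: v) ->
    (hessian f (x + t *: v))^T = hessian f (x + t *: v) ->
  is_derive t 1 (fun t : R => dot (gradient f (x + t *: v)) w)
    (dot w (hessian f (x + t *: v) *m v)).
Proof.
move=> dg sH; set y := x + t *: v.
pose gr i z := gradient f z i 0.
have dgr i : differentiable (gr i) y.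
  exact: (differentiable_comp dg (differentiable_coord _ _ _)).
have dl i : is_derive t 1 (fun t => w i 0 *: (gr i (x + t *: v) : R^o))
   (w i 0 *: (dot (gradient (gr i) y) v : R^o)).
  exact: is_deriveZ (is_derive_line (dgr i)).
have -> : (fun t : R => dot (gradient f (x + t *: v)) w) =
    \sum_(i < d) (fun t => w i 0 *: (gr i (x + t *: v) : R^o)).
  apply/funext => s; rewrite fct_sumE dotE; apply: eq_bigr => i _.
  by rewrite mulrC.
have -> : dot w (hessian f y *m v) =
    \sum_(i < d) (w i 0 *: (dot (gradient (gr i) y) v : R^o)).
  rewrite dotE; apply: eq_bigr => i _; congr (_ * _).
  rewrite -sH mxE dotE; apply: eq_bigr => j _; congr (_ * _).
  rewrite !mxE; congr ('D_ _ _ _); apply/funext => z.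
  by rewrite /gr mxE.
exact: is_derive_sum.
Qed.

End LineDerivatives.

(** * Abstract form of the hypotheses on [f] *)

Lemma loewner_le_quad (R : realType) (d : nat) (A B C : 'M[R]_d) (c : R) (u : 'cV[R]_d) :
  loewner_le (A - B) (c *: C) ->
  dot u (A *m u) <= dot u (B *m u) + c * dot u (C *m u).
Proof.
move=> [_ /(_ u)]; rewrite !mulmxBl -scalemxAl !dotBr dotZr; lra.
Qed.

(* [g] and [Hs] stand for the gradient and the Hessian of [f], and [S] for the square
   root of the Hessian at [xs].  They are kept abstract because unifying the concrete
   directional derivatives at two different points is prohibitively slow. *)
Record self_concordant_model (R : realType) (d : nat) (f : 'cV[R]_d -> R) (M : R)
    (xs : 'cV[R]_d) (g : 'cV[R]_d -> 'cV[R]_d) (Hs : 'cV[R]_d -> 'M[R]_d)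
    (S : 'M[R]_d) : Prop := SelfConcordantModel {
  model_line : forall x v (t : R),
    is_derive t 1 (fun t : R => f (x + t *: v)) (dot (g (x + t *: v)) v);
  model_gradient_line : forall x v w (t : R),
    is_derive t 1 (fun t : R => dot (g (x + t *: v)) w) (dot w (Hs (x + t *: v) *m v));
  model_posdef : forall x, posdefmx (Hs x);
  model_param_gt0 : 0 < M;
  model_concordant : forall x y z u, dot u (Hs x *m u) <= dot u (Hs y *m u) +
    M * Num.sqrt (dot (x - y) (Hs z *m (x - y))) * dot u (Hs y *m u);
  model_minimizer : minimizer f xs;
  model_root_sym : S^T = S;
  model_root_unit : S \in unitmx;
  model_root_sqr : S *m S = Hs xs }.

(** * Geometry around the minimizer *)

Section LocalGeometry.
Variables (R : realType) (d : nat) (f : 'cV[R]_d -> R) (M : R) (xs : 'cV[R]_d).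
Variables (g : 'cV[R]_d -> 'cV[R]_d) (Hs : 'cV[R]_d -> 'M[R]_d) (S : 'M[R]_d).
Hypothesis model : self_concordant_model f M xs g Hs S.
Let dline := model_line model.
Let dgline := model_gradient_line model.
Let posH := model_posdef model.
Let hM := model_param_gt0 model.
Let ssc := model_concordant model.
Let hxs := model_minimizer model.
Let sS := model_root_sym model.
Let uS := model_root_unit model.
Let SS := model_root_sqr model.
Implicit Types (x y z u v w : 'cV[R]_d) (D t : R).

Definition min_norm u : R := Num.sqrt (dot u (Hs xs *m u)).
Local Notation N := min_norm.

Lemma dot_sqrt_hessian u v : dot (S *m u) (S *m v) = dot u (Hs xs *m v).
Proof. by rewrite dot_mulmxl sS mulmxA SS. Qed.

Lemma dot_inv_sqrt_hessian u v : dot (invmx S *m u) (S *m v) = dot u v.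
Proof. by rewrite dot_mulmxl trmx_inv sS mulKmx. Qed.

Lemma min_norm_ge0 u : 0 <= N u.
Proof. exact: sqrtr_ge0. Qed.

Lemma min_norm_sqr u : N u ^+ 2 = dot u (Hs xs *m u).
Proof. by rewrite sqr_sqrtr//; exact: posdefmx_quad_ge0. Qed.

Lemma min_norm_sqrE u : N u ^+ 2 = dot (S *m u) (S *m u).
Proof. by rewrite min_norm_sqr dot_sqrt_hessian. Qed.

Lemma min_normZ t u : N (t *: u) = `|t| * N u.
Proof.
rewrite /min_norm -scalemxAr dotZr dotZl mulrA -expr2 sqrtrM ?sqr_ge0//.
by rewrite sqrtr_sqr.
Qed.

Lemma min_normN u : N (- u) = N u.
Proof. by rewrite -scaleN1r min_normZ normrN1 mul1r. Qed.

Lemma dot_le_min_norm u v : dot (S *m u) (S *m v) <= N u * N v.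
Proof.
have := cauchy_schwarz (S *m u) (S *m v).
rewrite -!min_norm_sqrE -exprMn => h.
apply: le_trans (ler_norm _) _.
by rewrite -(@ler_pXn2r _ 2) ?nnegrE ?mulr_ge0 ?min_norm_ge0// real_normK ?num_real.
Qed.

Lemma min_normD u v : N (u + v) <= N u + N v.
Proof.
rewrite -(@ler_pXn2r _ 2) ?nnegrE ?addr_ge0 ?min_norm_ge0//.
rewrite min_norm_sqrE mulmxDr !(dotDl, dotDr) -!min_norm_sqrE (dotC (S *m v)).
by have := dot_le_min_norm u v; lra.
Qed.

(** A ball around [xs], scaled so that Hessians inside it agree with the one at [xs] up to the
    factor [1 + D] in both directions. *)
Definition near_min D z := M * N (z - xs) <= D.

Lemma near_min_ge0 D z : near_min D z -> 0 <= D.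
Proof. by apply: le_trans; rewrite mulr_ge0 ?min_norm_ge0 ?ltW. Qed.

Lemma near_min_segment D x v t : near_min D x -> near_min D (x + v) ->
  0 <= t <= 1 -> near_min D (x + t *: v).
Proof.
rewrite /near_min => hx hy /andP[t0 t1].
have -> : x + t *: v - xs = (1 - t) *: (x - xs) + t *: (x + v - xs).
  by apply/matrixP => i j; rewrite !mxE; ring.
have := min_normD ((1 - t) *: (x - xs)) (t *: (x + v - xs)).
rewrite !min_normZ !ger0_norm ?subr_ge0// => h.
apply: le_trans (_ : (1 - t) * (M * N (x - xs)) + t * (M * N (x + v - xs)) <= _).
  by apply: le_trans (ler_wpM2l (ltW hM) h) _; lra.
have : (1 - t) * (M * N (x - xs)) <= (1 - t) * D by rewrite ler_wpM2l ?subr_ge0.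
have : t * (M * N (x + v - xs)) <= t * D by rewrite ler_wpM2l.
lra.
Qed.

(** Self-concordance allows the local norm to be taken at a third point. Taking it at [xs] lets the
    same [D] serve here and, with [z] and [xs] exchanged, in [hessian_lower]. *)
Lemma hessian_upper D z u : near_min D z ->
  dot u (Hs z *m u) <= (1 + D) * N u ^+ 2.
Proof.
move=> hz; have := ssc z xs xs u; rewrite min_norm_sqr => h.
have := ler_wpM2r (posdefmx_quad_ge0 u (posH xs)) hz.
by rewrite mulrDl mul1r; move: h; rewrite -/(N _); lra.
Qed.

Lemma hessian_lower D z u : near_min D z ->
  N u ^+ 2 <= (1 + D) * dot u (Hs z *m u).
Proof.
move=> hz; have := ssc xs z xs u; rewrite min_norm_sqr -/(N _) -(opprB z xs) min_normN => h.
have := ler_wpM2r (posdefmx_quad_ge0 u (posH z)) hz.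
by rewrite mulrDl mul1r; move: h; lra.
Qed.

Let dlin (a t : R) : is_derive t 1 (fun t : R => a * t) a.
Proof.
by have := @is_deriveZ R R^o R^o id a t 1 1 (is_derive_id t 1); rewrite [_ *: 1]mulr1.
Qed.

Let dquad (a b t : R) : is_derive t 1 (fun t : R => a * t + b * (t ^+ 2 / 2)) (a + b * t).
Proof. exact: is_deriveD (dlin a t) (is_deriveZ b (is_derive_sqr_half t)). Qed.

Let daff (a b t : R) : is_derive t 1 (fun t : R => a + b * t) b.
Proof.
rewrite -[X in is_derive _ _ _ X]add0r.
exact: is_deriveD (is_derive_cst a t 1) (dlin b t).
Qed.

Lemma quadratic_upper D x v : near_min D x -> near_min D (x + v) ->
  f (x + v) <= f x + dot (g x) v + (1 + D) / 2 * N v ^+ 2.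
Proof.
move=> hx hy; pose a := dot (g x) v; pose b := (1 + D) * N v ^+ 2.
have := @ler_increment2 R _ _ _ _ _ _ 1 ler01 (fun t _ => dquad a b t)
  (fun t _ => dline x v t) (fun t _ => daff a b t) (fun t _ => dgline x v v t).
rewrite !(scale0r, addr0, mulr0, expr0n, scale1r)/= -/a /b => h.
have := h (fun t ht => hessian_upper v (near_min_segment hx hy ht)) (lexx _).
by rewrite !mul0r !mulr0 !addr0 expr1n; lra.
Qed.

Lemma quadratic_lower D x v : near_min D x -> near_min D (x + v) ->
  f x + dot (g x) v + N v ^+ 2 / (2 * (1 + D)) <= f (x + v).
Proof.
move=> hx hy; pose a := dot (g x) v; pose b := N v ^+ 2 / (1 + D).
have D0 := near_min_ge0 hx.
have := @ler_increment2 R _ _ _ _ _ _ 1 ler01 (fun t _ => dline x v t)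
  (fun t _ => dquad a b t) (fun t _ => dgline x v v t) (fun t _ => daff a b t).
rewrite !(scale0r, addr0, mulr0, expr0n, scale1r)/= -/a => h.
have -> : N v ^+ 2 / (2 * (1 + D)) = b / 2.
  by rewrite /b; field; apply/eqP; lra.
have := h _ (lexx _); rewrite !mul0r !mulr0 !addr0 expr1n.
move=> h'; have := h' _; clear h h' => h.
have : b * (1 / 2) <= f (x + v) - f x - a; last by lra.
have /h : forall t, 0 <= t <= 1 -> b <= dot v (Hs (x + t *: v) *m v).
  move=> t ht; rewrite /b ler_pdivrMr; last lra.
  by rewrite mulrC; apply: hessian_lower; apply: near_min_segment.
lra.
Qed.

Lemma gradient_monotone D x v : near_min D x -> near_min D (x + v) ->
  N v ^+ 2 / (1 + D) <= dot (g (x + v) - g x) v.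
Proof.
move=> hx hy; have D0 := near_min_ge0 hx.
have := @ler_increment R _ _ _ _ 0 1 ler01 (fun t _ => dgline x v v t)
  (fun t _ => dlin (N v ^+ 2 / (1 + D)) t).
rewrite mulr0 mulr1 scale0r addr0 scale1r subr0 dotBl; apply => t ht.
rewrite ler_pdivrMr; last lra.
by rewrite mulrC; apply: hessian_lower; apply: near_min_segment.
Qed.

(* With [w] dual to [y], [(2 w - (1 + D) v)^T g] has derivative
   [2 w^T H v - (1 + D) v^T H v <= w^T H w / (1 + D) <= N w ^ 2] along the segment,
   by completing the square in the local metric. *)
Lemma gradient_cocoercive D x v (y := g (x + v) - g x) :
  near_min D x -> near_min D (x + v) ->
  dot (invmx S *m y) (invmx S *m y) <= (1 + D) * dot y v.
Proof.
move=> hx hy; have D0 := near_min_ge0 hx.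
pose w := invmx S *m (invmx S *m y).
have Sw : S *m w = invmx S *m y by rewrite mulKVmx.
have yw : dot y w = dot (invmx S *m y) (invmx S *m y).
  by rewrite -(dot_inv_sqrt_hessian y w) Sw.
have Nw : N w ^+ 2 = dot y w by rewrite min_norm_sqrE Sw yw.
have := @ler_increment R _ _ _ _ 0 1 ler01 (fun t _ => dlin (N w ^+ 2) t)
  (fun t _ => dgline x v (2 *: w - (1 + D) *: v) t).
rewrite mulr0 mulr1 scale0r addr0 scale1r subr0 -dotBl -/y => h.
suff : dot y (2 *: w - (1 + D) *: v) <= N w ^+ 2.
  by rewrite dotBr !dotZr Nw yw; lra.
apply: h => t ht; set K := Hs _.
have [sK _] : posdefmx K by exact: posH.
have q : 0 <= dot (w - (1 + D) *: v) (K *m (w - (1 + D) *: v)).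
  by apply: posdefmx_quad_ge0; exact: posH.
have up : dot w (K *m w) <= (1 + D) * N w ^+ 2.
  by apply: hessian_upper; apply: near_min_segment.
rewrite -(ler_pM2l (_ : 0 < 1 + D)); last lra.
have vw : dot v (K *m w) = dot w (K *m v) by rewrite dotC dot_mulmxl sK.
move: q; rewrite mulmxBr -scalemxAr !(dotBl, dotBr, dotZl, dotZr) vw; lra.
Qed.

Lemma gradient_min : g xs = 0.
Proof.
have hd v : dot (g xs) v = 0.
  have hm : is_derive (0 : R) 1 (fun t => f (xs + t *: v)) 0.
    have le11 : -1 <= 1 :> R by lra.
    apply: (derive1_at_min le11).
    - by move=> t _; have [] := dline xs v t.
    - by rewrite in_itv/= ltrN10 ltr01.
    - by move=> t _; rewrite scale0r addr0; exact: hxs.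
  have d0 := dline xs v 0; rewrite scale0r addr0 in d0.
  by rewrite -(@derive_val _ _ _ _ _ _ _ d0) (@derive_val _ _ _ _ _ _ _ hm).
by apply/eqP; rewrite -dot_eq0 hd.
Qed.

Lemma gap_ge0 x : 0 <= gap f xs x.
Proof. by rewrite subr_ge0 hxs. Qed.

Lemma Dgap_ge0 x : 0 <= Dgap f M xs x.
Proof.
have [] := @omega_invP R (M ^+ 2 * gap f xs x / 4); last by rewrite /Dgap; lra.
by rewrite divr_ge0// mulr_ge0 ?sqr_ge0 ?gap_ge0.
Qed.

Lemma omega_Dgap x : omega (Dgap f M xs x / 2) = M ^+ 2 * gap f xs x / 4.
Proof.
have c0 : 0 <= M ^+ 2 * gap f xs x / 4.
  by rewrite divr_ge0// mulr_ge0 ?sqr_ge0 ?gap_ge0.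
have [_ e] := omega_invP c0; rewrite -[RHS]e; congr (omega _).
by rewrite /Dgap; field.
Qed.

Lemma Dgap_le D x : 0 <= D -> M ^+ 2 * gap f xs x / 4 <= omega (D / 2) -> Dgap f M xs x <= D.
Proof.
move=> D0; rewrite -omega_Dgap => h; rewrite leNgt; apply/negP => lt.
have : omega (D / 2) < omega (Dgap f M xs x / 2) by apply: omega_lt; lra.
lra.
Qed.

Lemma le_Dgap x z : f z <= f x -> Dgap f M xs z <= Dgap f M xs x.
Proof.
move=> zx; apply: Dgap_le; first exact: Dgap_ge0.
rewrite omega_Dgap ler_pM2r// ler_wpM2l ?sqr_ge0// /gap; lra.
Qed.

(* Along the ray from [xs] the second derivative is at least
   [r^2 / (1 + M r t) >= r^2 / (1 + M r t / 2)^2], and the right-hand side is the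
   second derivative of [4 / M^2 * omega (M r t / 2)]. *)
Lemma near_min_Dgap x : near_min (Dgap f M xs x) x.
Proof.
pose v := x - xs; pose r := N v; pose u := M * r / 2.
have r0 : 0 <= r := min_norm_ge0 v.
have u0 : 0 <= u by rewrite /u divr_ge0// mulr_ge0// ltW.
have [ur|ru] := ltP (omega (Dgap f M xs x / 2)) (omega u); last first.
  rewrite /near_min -/v -/r leNgt; apply/negP => lt.
  have : omega (Dgap f M xs x / 2) < omega u.
    by apply: omega_lt; [have := Dgap_ge0 x; lra|rewrite /u; lra].
  lra.
exfalso; move: ur; rewrite omega_Dgap ltNge => /negP; apply.
have k0 t : 0 <= t <= 1 -> 0 < 1 + u * t.
  by move=> /andP[t0 _]; have := mulr_ge0 u0 t0; lra.
have dk t : 0 <= t <= 1 -> is_derive t 1 (fun t => omega (u * t)) (u * (u * t / (1 + u * t))).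
  move=> t01; have d1 : is_derive (u * t) 1 (@omega R) (u * t / (1 + u * t)).
    by apply: is_derive_omega; have := k0 t t01; lra.
  by have := @is_derive1_comp R _ _ t _ _ d1 (dlin u t); rewrite mulrC.
have dk' t : 0 <= t <= 1 ->
    is_derive t 1 (fun t => u * (u * t / (1 + u * t))) (u ^+ 2 / (1 + u * t) ^+ 2).
  move=> t01; have kt := k0 t t01.
  have dV : is_derive t 1 (fun t => (1 + u * t)^-1) (- (1 + u * t) ^- 2 *: u).
    by apply: is_deriveV (daff 1 u t); rewrite gt_eqF.
  have dM := @is_deriveM R _ (fun t : R => u * t) (fun t : R => (1 + u * t)^-1) t 1 _ _
    (dlin u t) dV.
  have := @is_deriveZ R R^o R^o _ u t 1 _ dM.
  set e := _ *: _; suff -> : e = u ^+ 2 / (1 + u * t) ^+ 2 by [].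
  by rewrite /e /GRing.scale/=; field; rewrite gt_eqF.
have := @ler_increment2 R (fun t => M ^+ 2 / 4 * f (xs + t *: v)) _
  (fun t => M ^+ 2 / 4 * dot (g (xs + t *: v)) v) _
  (fun t => M ^+ 2 / 4 * dot v (Hs (xs + t *: v) *m v)) _ 1 ler01
  (fun t _ => is_deriveZ (M ^+ 2 / 4) (dline xs v t)) dk
  (fun t _ => is_deriveZ (M ^+ 2 / 4) (dgline xs v v t)) dk'.
rewrite !(scale0r, addr0, mulr0, mulr1, scale1r) !mul0r mulr0 omega0 subr0.
have -> : xs + v = x by rewrite addrC subrK.
rewrite gradient_min dot0l mulr0 /gap => h; apply: le_trans (h _ _) _; last by lra.
- move=> t t01; have kt := k0 t t01; have /andP[t0 _] := t01.
  (* The radius [M * (t * r)] of the point itself serves as [D], which produces the factor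
     [1 + M r t]. *)
  have nm : near_min (M * (t * r)) (xs + t *: v).
    by rewrite /near_min addrC addKr min_normZ ger0_norm.
  have := hessian_lower v nm; rewrite -/r => hl.
  rewrite ler_pdivrMr ?exprn_gt0//.
  set q := dot v _ in hl *.
  have q0 : 0 <= q by apply: posdefmx_quad_ge0; exact: posH.
  have -> : u ^+ 2 = M ^+ 2 / 4 * r ^+ 2 by rewrite /u; field.
  rewrite -[leRHS]mulrA ler_wpM2l ?divr_ge0 ?sqr_ge0//.
  apply: le_trans hl _; rewrite mulrC ler_wpM2l//.
  have := sqr_ge0 (u * t); rewrite /u; lra.
- by [].
Qed.

(** Gradient domination: [quadratic_lower] from [x] towards [xs], combined with the square of
    [(1 + D) S^-1 g + S (xs - x)]. *)
Lemma gap_le_gradient D x : near_min D x ->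
  gap f xs x <= (1 + D) / 2 * dot (invmx S *m g x) (invmx S *m g x).
Proof.
move=> hx; have D0 := near_min_ge0 hx.
have hy : near_min D (x + (xs - x)).
  by rewrite addrC subrK /near_min subrr -(scale0r 0) min_normZ normr0 mul0r mulr0.
have := quadratic_lower hx hy; rewrite [x + _]addrC subrK => h.
have := dot_ge0 ((1 + D) *: (invmx S *m g x) + S *m (xs - x)).
rewrite !(dotDl, dotDr, dotZl, dotZr) dot_inv_sqrt_hessian (dotC (S *m _)).
rewrite dot_inv_sqrt_hessian -min_norm_sqrE.
set e := dot _ (invmx S *m _); set c := dot (g x) _ in h *.
move: h; set n := N _ ^+ 2 => h1 h2.
have : 0 <= ((1 + D) ^+ 2 * e + 2 * (1 + D) * c + n) / (2 * (1 + D)).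
  by rewrite divr_ge0//; lra.
have -> : ((1 + D) ^+ 2 * e + 2 * (1 + D) * c + n) / (2 * (1 + D)) =
  (1 + D) / 2 * e + c + n / (2 * (1 + D)) by field; apply/eqP; lra.
rewrite /gap; lra.
Qed.

(** Cocoercivity between [xs] and [x] gives [e <= (1 + D) g^T (x - xs)]; square it, apply
    Cauchy-Schwarz and cancel one factor [e]. *)
Lemma gradient_le_dist D x : near_min D x ->
  dot (invmx S *m g x) (invmx S *m g x) <= (1 + D) ^+ 2 * N (x - xs) ^+ 2.
Proof.
move=> hx; have D0 := near_min_ge0 hx.
have hs : near_min D xs.
  by rewrite /near_min subrr -(scale0r 0) min_normZ normr0 mul0r mulr0.
have := @gradient_cocoercive D xs (x - xs) hs; rewrite [xs + _]addrC subrK gradient_min subr0.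
move=> /(_ hx); set e := dot _ (invmx S *m _) => h.
have := cauchy_schwarz (invmx S *m g x) (S *m (x - xs)).
rewrite dot_inv_sqrt_hessian -min_norm_sqrE -/e => cs.
have e0 : 0 <= e := dot_ge0 _.
have [->|en0] := eqVneq e 0; first by rewrite mulr_ge0 ?sqr_ge0.
have eg0 : 0 < e by rewrite lt_def en0.
rewrite -(ler_pM2l eg0); apply: le_trans (_ : ((1 + D) * dot (g x) (x - xs)) ^+ 2 <= _).
  by rewrite -expr2 lerXn2r// nnegrE// (le_trans e0).
by rewrite exprMn [leRHS]mulrCA ler_wpM2l ?sqr_ge0.
Qed.

End LocalGeometry.

(** * Inequalities between the constants *)

Definition armijo_wolfe_params (R : realType) (alpha beta : R) : Prop :=
  [/\ 0 < alpha, alpha < beta, beta < 1 & alpha < 1 / 2].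

Section Constants.
Variables (R : realType) (alpha beta : R).
Hypothesis hp : armijo_wolfe_params alpha beta.

Local Notation d2 := (delta2 alpha).
Local Notation d3 := (delta3 beta).
Local Notation d4 := (delta4 alpha beta).
Local Notation d5 := (delta5 alpha beta).
Local Notation d6 := (delta6 alpha beta).
Local Notation d7 := (delta7 alpha beta).
Local Notation d8 := (delta8 alpha beta).
Local Notation sq := (Num.sqrt (2 * (1 - alpha))).

(** Threshold on [D t] for accepting the unit step: [1 / 16] controls the trial point, [sq - 1]
    gives the Armijo condition and [d3 - 1] the Wolfe condition. *)
Definition dist_small : R := Num.min (1 / 16) (Num.min (sq - 1) (d3 - 1)).

Local Ltac params := case: hp => ? ? ? ?.

Lemma sqrt_armijo_gt1 : 1 < sq.
Proof.
params; by rewrite -[ltLHS]sqrtr1 ltr_sqrt; lra.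
Qed.

Lemma sqr_sqrt_armijo : sq * sq = 2 * (1 - alpha).
Proof.
params; by rewrite -expr2 sqr_sqrtr//; lra.
Qed.

Lemma delta3_gt1 : 1 < d3.
Proof.
params; have h : 0 < Num.sqrt (1 - beta) by rewrite sqrtr_gt0; lra.
have h1 : Num.sqrt (1 - beta) < Num.sqrt 1 by rewrite ltr_sqrt; lra.
by rewrite /delta3 ltr_pdivlMr// mul1r -[ltRHS]sqrtr1.
Qed.

Lemma sqr_delta3 : (1 - beta) * (d3 * d3) = 1.
Proof.
params; have h : 0 < Num.sqrt (1 - beta) by rewrite sqrtr_gt0; lra.
have e : Num.sqrt (1 - beta) ^+ 2 = 1 - beta by rewrite sqr_sqrtr//; lra.
by rewrite /delta3 -[X in X * _]e; field; rewrite gt_eqF.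
Qed.

Lemma delta2_ge : 15 / 16 <= d2.
Proof. by rewrite le_max lexx. Qed.

Lemma delta2_sqrt_ge1 : 1 <= d2 * sq.
Proof.
params; have h := sqrt_armijo_gt1.
by rewrite -ler_pdivrMr ?le_max ?lexx ?orbT//; lra.
Qed.

Lemma delta2_lt1 : d2 < 1.
Proof.
params; have h := sqrt_armijo_gt1.
by rewrite gt_max; apply/andP; split; [lra|rewrite ltr_pdivrMr; lra].
Qed.

Lemma dist_small_gt0 : 0 < dist_small.
Proof.
params; have h := sqrt_armijo_gt1; have h3 := delta3_gt1.
by rewrite !lt_min !subr_gt0 h h3 !andbT; lra.
Qed.

Lemma delta6_gt0 : 0 < d6.
Proof.
params; have h : 0 < 2 * alpha * (1 - beta) by rewrite mulr_gt0//; lra.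
have h1 : alpha * (1 - beta) <= alpha * (1 - alpha) by rewrite ler_wpM2l//; lra.
rewrite ln_gt0// ltr_pdivlMr// mul1r.
have := sqr_ge0 (alpha - 1 / 2); lra.
Qed.

Lemma omega_delta2_gt0 : 0 < omega (d2 - 1).
Proof.
params; have := delta2_ge; have := delta2_lt1 => h1 h2.
apply: lt_le_trans (omega_ge_sqr_neg _ _); try lra.
by rewrite divr_gt0// exprn_even_gt0//=; apply/eqP; lra.
Qed.

Lemma omega_delta3_gt0 : 0 < omega (d3 - 1).
Proof.
params; by rewrite -omega0; apply: omega_lt => //; have := delta3_gt1; lra.
Qed.

Lemma delta4_min_gt0 : 0 < Num.min (omega (d2 - 1)) (omega (d3 - 1)).
Proof. by rewrite lt_min omega_delta2_gt0 omega_delta3_gt0. Qed.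

Lemma delta4_gt0 : 0 < d4.
Proof. by rewrite divr_gt0// delta4_min_gt0. Qed.

Lemma delta5_ge : 4 <= d5 /\ 4 / (2 * d2 - 17 / 16) <= d5.
Proof.
params; have h2 := delta2_ge; have h3 := delta2_lt1; have h4 := delta3_gt1.
have h : 4 / (2 * d2 - 17 / 16) <= d5.
  by rewrite le_max; apply/orP; right; rewrite ler_pM2r ?invr_gt0; lra.
split => //; apply: le_trans h; rewrite ler_pdivlMr; lra.
Qed.

(** [omega] is monotone on each side of [0], so outside the range it is at least its value at one of
    the endpoints, and [d4] is the inverse of the smaller endpoint value. *)
Lemma outside_good_range (rho : R) : 0 < rho -> ~~ (d2 <= rho <= d3) ->
  1 <= d4 * omega (rho - 1).
Proof.
params; move=> r0 /nandP h; rewrite /delta4 mul1r ler_pdivlMl ?delta4_min_gt0// mulr1.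
have h1 := delta2_lt1; have h3 := delta3_gt1.
rewrite ge_min; apply/orP; case: h; rewrite -ltNge => h.
  by left; apply: omega_anti; lra.
by right; apply: omega_mono; lra.
Qed.

(* With [x = rho - 1], [2 ln rho - ln (2 rho - 1) = ln (1 + x^2 / (1 + 2 x))]. *)
Lemma good_step_bound (rho D : R) : d2 <= rho -> 0 <= D -> D <= 1 / 16 ->
  2 * ln rho + 2 * ln (1 + D) - ln (2 * rho - 1 - D) <=
  d5 * omega (rho - 1)
  + D * (1 + (2 * d2 - 1 / 16 - ln d2) / (2 * d2 - 17 / 16)).
Proof.
params; move=> rd D0 D1; have h2 := delta2_ge; have h3 := delta2_lt1.
have [d54 d5b] := delta5_ge.
have lnd2 : ln d2 <= 0 by rewrite ln_le0; lra.
have p1 : 0 < 2 * d2 - 17 / 16 by lra.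
have p2 : 0 < 2 * rho - 1 by lra.
have p3 : 0 < 2 * rho - 1 - D by lra.
pose x := rho - 1.
have rx : rho = 1 + x by rewrite /x; lra.
have E1 : ln (1 + D) <= D by rewrite le_ln1Dx//; lra.
have E2 : ln (2 * rho - 1) - ln (2 * rho - 1 - D) <= D / (2 * d2 - 17 / 16).
  rewrite -ln_div ?posrE//; apply: le_trans (ln_le_sub1 _) _; first exact: divr_gt0.
  have -> : (2 * rho - 1) / (2 * rho - 1 - D) - 1 = D / (2 * rho - 1 - D).
    by field; apply/eqP; lra.
  by rewrite ler_wpM2l// lef_pV2 ?posrE//; lra.
have E3 : (2 * d2 - 1 / 16 - ln d2) / (2 * d2 - 17 / 16) >=
    1 + (2 * d2 - 17 / 16)^-1.
  have -> : 1 + (2 * d2 - 17 / 16)^-1 = (2 * d2 - 1 / 16) / (2 * d2 - 17 / 16).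
    by field; apply/eqP; lra.
  by rewrite ler_pM2r ?invr_gt0//; lra.
have E4 : D * (1 + (2 * d2 - 17 / 16)^-1) <=
    D * ((2 * d2 - 1 / 16 - ln d2) / (2 * d2 - 17 / 16)) by rewrite ler_wpM2l.
suff E5 : 2 * ln rho - ln (2 * rho - 1) <= d5 * omega x.
  by move: E2 E4; rewrite -/x; lra.
have -> : 2 * ln rho - ln (2 * rho - 1) = ln (rho ^+ 2 / (2 * rho - 1)).
  have r0 : 0 < rho by lra.
  by rewrite ln_div ?posrE ?exprn_gt0// lnXn// mulr2n; lra.
apply: le_trans (ln_le_sub1 _) _; first by rewrite divr_gt0 ?exprn_gt0//; lra.
have -> : rho ^+ 2 / (2 * rho - 1) - 1 = x ^+ 2 / (2 * rho - 1).
  by rewrite /x; field; rewrite gt_eqF.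
(* The two signs of [x] use different quadratic lower bounds for [omega], matched by the two lower
   bounds [4] and [4 / (2 * d2 - 17 / 16)] for [d5]. *)
have [x0|x0] := leP 0 x.
  have w := omega_ge_sqr_pos x0.
  apply: le_trans (_ : 4 * (x ^+ 2 / (2 * (1 + x))) <= _); last first.
    have w0 : 0 <= x ^+ 2 / (2 * (1 + x)) by rewrite divr_ge0 ?sqr_ge0//; lra.
    by apply: ler_pM => //; lra.
  have -> : 4 * (x ^+ 2 / (2 * (1 + x))) = x ^+ 2 * (2 / (1 + x)).
    by field; apply/eqP; lra.
  rewrite ler_wpM2l ?sqr_ge0// -[leLHS]mul1r ler_pdivrMr// mulrAC ler_pdivlMr; lra.
have w := @omega_ge_sqr_neg R x ltac:(lra) (ltW x0).
apply: le_trans (_ : 4 / (2 * d2 - 17 / 16) * (x ^+ 2 / 2) <= _); last first.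
  apply: ler_pM => //; last by rewrite divr_ge0 ?sqr_ge0.
  by rewrite divr_ge0//; lra.
have -> : 4 / (2 * d2 - 17 / 16) * (x ^+ 2 / 2) = x ^+ 2 * (2 / (2 * d2 - 17 / 16)).
  by field; apply/eqP; lra.
rewrite ler_wpM2l ?sqr_ge0// -[leLHS]mul1r ler_pdivrMr// mulrAC ler_pdivlMr; lra.
Qed.

Lemma delta8_ge : 2 * d4 * d6 <= d8.
Proof.
params; have h2 := delta2_ge; have h3 := delta2_lt1; have [h5 _] := delta5_ge.
have lnd2 : ln d2 <= 0 by rewrite ln_le0; lra.
have : 0 <= (2 * d2 - 1 / 16 - ln d2) / (2 * d2 - 17 / 16) by rewrite divr_ge0; lra.
rewrite /delta8; lra.
Qed.

(** Makes one extra step of cost [d6] affordable: with [2 * d4 * d6 <= d8] it gives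
    [d6 <= d8 * D / 25] as soon as [D] exceeds [dist_small]. The proof bounds [omega x] by
    [x^2 / (1 + x)]. *)
Lemma delta4_dist_small : 25 / 2 <= d4 * dist_small.
Proof.
params; have h2 := delta2_ge; have h3 := delta2_lt1; have h4 := delta3_gt1.
have hq := sqrt_armijo_gt1; have hs := dist_small_gt0.
suff : Num.min (omega (d2 - 1)) (omega (d3 - 1)) <= 2 / 25 * dist_small.
  rewrite /delta4 mul1r => h; rewrite ler_pdivlMl ?delta4_min_gt0//.
  by have := h; lra.
have W : omega (d2 - 1) <= (1 - d2) * (1 / 15).
  apply: le_trans (omega_le_sqr _) _; first lra.
  rewrite ler_pdivrMr; last lra.
  have : (1 - d2) * (1 - d2) <= (1 - d2) * (1 / 16) by rewrite ler_wpM2l; lra.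
  have : (1 - d2) * (15 / 16) <= (1 - d2) * d2 by rewrite ler_wpM2l; lra.
  lra.
have [h16|h16] := leP (1 / 16) (Num.min (sq - 1) (d3 - 1)).
  by rewrite /dist_small (min_l h16) ge_min; apply/orP; left; lra.
rewrite /dist_small (min_r (ltW h16)).
have [hqd|hqd] := leP (sq - 1) (d3 - 1).
  rewrite ge_min; apply/orP; left.
  have := delta2_sqrt_ge1.
  have : (1 - d2) * 1 <= (1 - d2) * sq by rewrite ler_wpM2l; lra.
  lra.
rewrite ge_min; apply/orP; right.
move: h16; rewrite (min_r (ltW hqd)) => h16.
apply: le_trans (omega_le_sqr _) _; first lra.
have -> : 1 + (d3 - 1) = d3 by ring.
rewrite ler_pdivrMr; last lra.
have : (d3 - 1) * (d3 - 1) <= (d3 - 1) * (1 / 16) by rewrite ler_wpM2l; lra.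
have : (d3 - 1) * 1 <= (d3 - 1) * d3 by rewrite ler_wpM2l; lra.
lra.
Qed.

(** A gap of at most [delta1] thus forces [D] to be at most [dist_small]. *)
Lemma delta1_le (M : R) : 0 < M -> delta1 M alpha beta <= 4 / M ^+ 2 * omega (dist_small / 2).
Proof.
move=> M0; rewrite /delta1 /dist_small.
rewrite !ge_min; apply/orP; right.
have [_|_] := leP (1 / 16) _.
  by apply/orP; left; have -> : 1 / 16 / 2 = 1 / 32 :> R by field.
apply/orP; right; have [_|_] := leP (sq - 1) _; first by rewrite lexx.
by apply/orP; right; rewrite [1 / 2 * _]mulrC mulrA mulr1 lexx.
Qed.

Lemma delta1_gt0 (M : R) : 0 < M -> 0 < delta1 M alpha beta.
Proof.
params; move=> M0; have hq := sqrt_armijo_gt1; have h4 := delta3_gt1.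
have m : 0 < 4 / M ^+ 2 by rewrite divr_gt0 ?exprn_gt0.
have W (x : R) : 0 < x -> 0 < 4 / M ^+ 2 * omega x.
  by move=> x0; rewrite mulr_gt0// -omega0 omega_lt.
rewrite !lt_min !W//; try lra.
by move: h4; rewrite /delta3; lra.
Qed.

(** From [alpha (1 - beta) <= alpha (1 - alpha) <= 1 / 4]. *)
Lemma kappa_ge12 (D : R) : 0 <= D -> 12 <= 3 * (1 + D) ^+ 2 / (alpha * (1 - beta)).
Proof.
params; move=> D0; have h : 0 < alpha * (1 - beta) by rewrite mulr_gt0//; lra.
have h1 : alpha * (1 - beta) <= alpha * (1 - alpha) by rewrite ler_wpM2l//; lra.
rewrite ler_pdivlMr//.
have : 1 <= (1 + D) ^+ 2 by rewrite exprn_ege1//; lra.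
have := sqr_ge0 (alpha - 1 / 2); lra.
Qed.

End Constants.

(** * From one-step estimates on real sequences to the superlinear rate *)

Section Summation.
Variables (R : realType) (alpha beta M : R).
Hypotheses (hp : armijo_wolfe_params alpha beta) (hM : 0 < M).
Variables (C D PT PB rho : nat -> R).
Let a t := 1 - C t.+1 / C t.
Local Notation d4 := (delta4 alpha beta).
Local Notation d5 := (delta5 alpha beta).
Local Notation d6 := (delta6 alpha beta).
Local Notation d7 := (delta7 alpha beta).
Local Notation d8 := (delta8 alpha beta).
Local Notation K := ((2 * delta2 alpha - 1 / 16 - ln (delta2 alpha))
    / (2 * delta2 alpha - 17 / 16)).
Local Notation eps := (dist_small alpha beta).
Let kappa := 3 * (1 + D 0%N) ^+ 2 / (alpha * (1 - beta)).
Let t0 := Num.max (PB 0%N) (kappa * ln (C 0%N / delta1 M alpha beta)).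

Hypothesis C_gt0 : forall t, 0 < C t.
Hypothesis C_decr : forall t, C t.+1 < C t.
Hypothesis D_ge0 : forall t, 0 <= D t.
Hypothesis D_gap : forall t, omega (D t / 2) = M ^+ 2 * C t / 4.
Hypothesis PT_ge0 : forall t, 0 <= PT t.
Hypothesis PB_ge0 : forall t, 0 <= PB t.
Hypothesis rho_gt0 : forall t, 0 < rho t.
Hypothesis global_step : forall t,
  - ln (a t) <= d6 + (PT t - PT t.+1) + 2 * D t.
Hypothesis linear_step : forall t,
  - ln (a t) <= ln ((1 + D 0%N) ^+ 2 / (2 * alpha * (1 - beta))) + (PB t - PB t.+1).
Hypothesis omega_step : forall t, omega (rho t - 1) <= PT t - PT t.+1 + 2 * D t.
Hypothesis good_step : forall t, D t <= eps ->
  delta2 alpha <= rho t <= delta3 beta ->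
  - ln (a t) <= PT t - PT t.+1 + d5 * omega (rho t - 1) + D t * (2 + K).

Local Ltac params := case: (hp) (hM) => ? ? ? ? ?.

Let a_gt0 t : 0 < a t.
Proof. by rewrite subr_gt0 ltr_pdivrMr// mul1r. Qed.

Let d8E : d8 = 2 + K + 2 * (d4 * d6 + d5).
Proof. rewrite /delta8; ring. Qed.

Let A_ge0 : 0 <= d4 * d6 + d5.
Proof.
have [h5 _] := delta5_ge hp.
have h4 := delta4_gt0 hp.
have h6 := delta6_gt0 hp.
have := mulr_ge0 (ltW h4) (ltW h6); lra.
Qed.

Let K_ge0 : 0 <= K.
Proof.
have h2 := delta2_ge alpha; have h3 := delta2_lt1 hp.
have lnd2 : ln (delta2 alpha) <= 0 by rewrite ln_le0; lra.
by rewrite divr_ge0; lra.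
Qed.

(** Three cases. If [D t] is large, the indicator pays for [d6]; if [rho t] is out of range,
    [d4 * d6 * omega (rho t - 1)] pays for it; otherwise [good_step] applies. The [omega] terms are
    then charged to the drop of [PT] by [omega_step]. *)
Lemma step_bound t : - ln (a t) <=
  (1 + (d4 * d6 + d5)) * (PT t - PT t.+1) + d8 * D t + d6 * (eps < D t)%R%:R.
Proof.
have h4 := delta4_gt0 hp.
have h6 := delta6_gt0 hp.
have [h5 _] := delta5_ge hp.
have D0 := D_ge0 t; have KD := mulr_ge0 K_ge0 D0.
have w0 : 0 <= omega (rho t - 1) by apply: omega_ge0; have := rho_gt0 t; lra.
have d6w : 0 <= d4 * d6 * omega (rho t - 1) by rewrite mulr_ge0// ltW// mulr_gt0.
have d5w : 0 <= d5 * omega (rho t - 1) by rewrite mulr_ge0//; lra.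
have Aw : (d4 * d6 + d5) * omega (rho t - 1) <=
    (d4 * d6 + d5) * (PT t - PT t.+1 + 2 * D t) by rewrite ler_wpM2l.
have G := global_step t; rewrite d8E.
have [hD|hD] := ltP eps (D t); rewrite ?mulr1 ?mulr0.
  by move: G KD Aw d6w d5w; lra.
have [good|bad] := boolP (delta2 alpha <= rho t <= delta3 beta).
  by have := good_step hD good; move: KD Aw d6w d5w; lra.
have := outside_good_range hp (rho_gt0 t) bad.
rewrite -(ler_pM2l h6) => B.
by move: G KD Aw d6w d5w B; lra.
Qed.

Let SD n := \sum_(i < n) D i.
Let Nbig n := \sum_(i < n) (eps < D i)%R%:R : R.

Lemma sum_step_bound n : \sum_(i < n) - ln (a i) <=
  d7 * (PT 0%N - PT n) + d8 * SD n + d6 * Nbig n.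
Proof.
rewrite /SD /Nbig /delta7 -addrA; elim: n => [|n IH].
  by rewrite !big_ord0 subrr !mulr0 !addr0.
by rewrite !big_ord_recr/= (mulrDr d8) (mulrDr d6); have := step_bound n; move: IH; lra.
Qed.

Lemma D_nonincr n m : (n <= m)%N -> D m <= D n.
Proof.
move=> /subnKC <-; elim: (m - n)%N => [|k IH]; first by rewrite addn0.
apply: le_trans IH; rewrite addnS leNgt; apply/negP => lt.
have : omega (D (n + k) / 2) < omega (D (n + k).+1 / 2).
  by apply: omega_lt; [have := D_ge0 (n + k); lra|lra].
rewrite !D_gap ltr_pM2r// ltr_pM2l ?exprn_gt0// => h.
by have := lt_trans h (C_decr _); rewrite ltxx.
Qed.

Let lam := - ln ((1 + D 0%N) ^+ 2 / (2 * alpha * (1 - beta))).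

Lemma sum_ln_lower n : n%:R * lam - PB 0%N <= \sum_(i < n) ln (a i).
Proof.
suff : n%:R * lam - PB 0%N + PB n <= \sum_(i < n) ln (a i).
  by have := PB_ge0 n; lra.
elim: n => [|n IH]; first by rewrite big_ord0 mul0r sub0r addNr.
rewrite big_ord_recr/= -natr1 mulrDl mul1r; have := linear_step n.
by move: IH; rewrite /lam; lra.
Qed.

(* Tangent line of [expR] at [lam - 1]: [a i >= expR (lam - 1) * (2 + ln (a i) - lam)]. *)
Lemma sum_contraction_lower n : PB 0%N <= n%:R ->
  n%:R * expR (lam - 1) <= \sum_(i < n) a i.
Proof.
move=> hn; have h i : expR (lam - 1) * (1 + (ln (a i) - (lam - 1))) <= a i.
  have := expR_ge1Dx (ln (a i) - (lam - 1)).
  by rewrite -(ler_pM2l (expR_gt0 (lam - 1))) -expRD [lam - 1 + _]addrC subrK lnK ?posrE.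
(* By [sum_ln_lower] the tangent lines sum to at least [expR (lam - 1) * (2 n - PB 0)], and
   [PB 0 <= n]. *)
have : \sum_(i < n) expR (lam - 1) * (1 + (ln (a i) - (lam - 1))) <= \sum_(i < n) a i.
  by apply: ler_sum.
apply: le_trans; rewrite -mulr_sumr mulrC ler_wpM2l ?expR_ge0//.
rewrite big_split/= sumrB !sumr_const card_ord.
rewrite -[(lam - 1) *+ n]mulr_natl; have := sum_ln_lower n; lra.
Qed.

Lemma gap_le_exp n : C n <= C 0%N * expR (- \sum_(i < n) a i).
Proof.
elim: n => [|n IH]; first by rewrite big_ord0 oppr0 expR0 mulr1.
rewrite big_ord_recr/= opprD expRD mulrA.
have -> : C n.+1 = C n * (1 - a n).
  by rewrite /a opprB addrC subrK mulrC divfK// gt_eqF.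
apply: ler_pM => //; first exact: ltW.
- by rewrite /a opprB addrC subrK divr_ge0// ltW.
- exact: expR_ge1Dx.
Qed.

Let kappa12 : 12 <= kappa.
Proof. exact: kappa_ge12. Qed.

(** Since [expR lam] is [6 / kappa] and [expR 1 <= 137 / 50], the rate [expR (lam - 1)] is at least
    [2 * nu]. The factor [2] belongs to the gap, [nu] alone to [D]. *)
Let nu := 150 / (137 * kappa).

Lemma contraction_rate : 2 * nu <= expR (lam - 1).
Proof.
params; have k12 := kappa12; have D0 := D_ge0 0%N.
have ab : 0 < alpha * (1 - beta) by rewrite mulr_gt0//; lra.
have q0 : 0 < 2 * alpha * (1 - beta) / (1 + D 0%N) ^+ 2.
  by rewrite divr_gt0 ?exprn_gt0//; lra.
have -> : lam = ln (2 * alpha * (1 - beta) / (1 + D 0%N) ^+ 2).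
  by rewrite /lam -lnV ?invf_div// posrE -invf_div invr_gt0.
have E : 2 * alpha * (1 - beta) / (1 + D 0%N) ^+ 2 = 6 / kappa.
  by rewrite /kappa; field; rewrite !gt_eqF ?subr_gt0//; lra.
rewrite expRB lnK ?posrE// E ler_pdivlMr ?expR_gt0//.
have -> : 6 / kappa = 2 * nu * (137 / 50) by rewrite /nu; field; apply/eqP; lra.
rewrite ler_wpM2l ?expR1_le// mulr_ge0// /nu divr_ge0; lra.
Qed.

Lemma gap_linear n : PB 0%N <= n%:R -> C n <= C 0%N * expR (- (2 * (n%:R * nu))).
Proof.
move=> hn; apply: le_trans (gap_le_exp n) _.
rewrite ler_pM2l// ler_expR lerN2; apply: le_trans (sum_contraction_lower hn).
by rewrite mulrCA ler_wpM2l// contraction_rate.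
Qed.

(** [omega] is at most quadratic under scaling ([omega_scale]), so [D] decays at least at half the
    exponent of the gap. *)
Lemma D_linear n : PB 0%N <= n%:R -> D n <= D 0%N * expR (- (n%:R * nu)).
Proof.
move=> hn; set th := expR _; have th0 : 0 <= th := expR_ge0 _.
have nu0 : 0 <= n%:R * nu.
  by rewrite mulr_ge0// /nu divr_ge0//; have := kappa12; lra.
have th1 : th <= 1 by rewrite -expR0 ler_expR oppr_le0.
rewrite leNgt; apply/negP => lt.
have D0 := D_ge0 0%N.
have : omega (th * (D 0%N / 2)) < omega (D n / 2).
  apply: omega_lt; first by rewrite mulr_ge0//; lra.
  lra.
have := @omega_scale R th (D 0%N / 2) th0 th1 ltac:(lra).
rewrite !D_gap => h1 h2; have := le_lt_trans h1 h2.
have -> : th ^+ 2 = expR (- (2 * (n%:R * nu))).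
  by rewrite -expRM_natl; congr expR; rewrite mulrN.
have -> (e : R) : e * (M ^+ 2 * C 0%N / 4) = M ^+ 2 * (C 0%N * e) / 4 by ring.
rewrite ltr_pM2r// ltr_pM2l ?exprn_gt0// => h3.
by have := lt_le_trans h3 (gap_linear hn); rewrite ltxx.
Qed.

Lemma sum_D_bound n : SD n <= D 0%N * (PB 0%N + kappa - 1 / 25).
Proof.
have k12 := kappa12; have D0 := D_ge0 0%N; have P0 := PB_ge0 0%N.
have nu0 : 0 < nu by rewrite /nu divr_gt0//; lra.
pose T := (Num.truncn (PB 0%N)).+1.
have /andP[T1 T2] : (Num.truncn (PB 0%N))%:R <= PB 0%N < T%:R by exact: truncn_itv.
pose q := expR (- nu).
have q0 : 0 <= q := expR_ge0 _.
have q1 : q <= 1 by rewrite -expR0 ler_expR oppr_le0 ltW.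
(* Equivalently [q * nu <= 1 - q], which makes the geometric sum telescope. *)
have qnu : q * (1 + nu) <= 1.
  by rewrite -ler_pdivlMl ?expR_gt0// -expRN opprK mulr1 expR_ge1Dx.
have qE m : expR (- (m%:R * nu)) = q ^+ m.
  by rewrite -expRM_natl mulrN.
have early m : SD m <= m%:R * D 0%N.
  rewrite /SD mulr_natl -[X in _ *+ X](card_ord m) -sumr_const.
  by apply: ler_sum => i _; exact: D_nonincr.
have late k : SD (T + k) <= D 0%N * (T%:R + (1 - q ^+ k) / nu).
  elim: k => [|k IH].
    by rewrite addn0 expr0 subrr mul0r addr0 mulrC.
  rewrite addnS /SD big_ord_recr/= -/(SD _).
  have DT : D (T + k)%N <= D 0%N * q ^+ k.+1.
    apply: le_trans (D_linear _) _.
      by rewrite natrD; have := ler0n R k; lra.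
    rewrite qE ler_wpM2l// /T addSn -addnS exprD ler_piMl ?exprn_ge0//.
    by rewrite exprn_ile1.
  have : D 0%N * (q ^+ k.+1 * nu) <= D 0%N * (q ^+ k - q ^+ k.+1).
    rewrite ler_wpM2l//; have := ler_wpM2l (exprn_ge0 k q0) qnu.
    by rewrite !exprS; lra.
  rewrite -(ler_pM2r (_ : 0 < nu^-1)) ?invr_gt0//.
  have -> : D 0%N * (q ^+ k.+1 * nu) / nu = D 0%N * q ^+ k.+1.
    by field; rewrite gt_eqF.
  by move: IH DT; lra.
have nuE : nu^-1 = 137 / 150 * kappa by rewrite /nu; field; apply/eqP; lra.
apply: le_trans (_ : D 0%N * (T%:R + nu^-1) <= _); last first.
  by rewrite ler_wpM2l// nuE; move: T1; rewrite /T -natr1; lra.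
have [nT|Tn] := leqP n T.
  apply: le_trans (early n) _; rewrite mulrC ler_wpM2l//.
  have : n%:R <= T%:R :> R by rewrite ler_nat.
  have : 0 < nu^-1 by rewrite invr_gt0.
  lra.
have := late (n - T)%N; rewrite subnKC ?(ltnW Tn)// => h.
apply: le_trans h _; rewrite ler_wpM2l// lerD2l.
by rewrite ler_pdivrMr// mulVf ?gt_eqF// gerBl exprn_ge0.
Qed.

(** From index [t0] on, [gap_linear] applies, and since [2 * nu] exceeds [1 / kappa] the gap is at
    most [delta1]; but [eps < D i] would put it above [delta1]. *)
Lemma big_D_early i : eps < D i -> i%:R < t0.
Proof.
move=> hD; rewrite ltNge; apply/negP; rewrite ge_max => /andP[h1 h2].
params; have k12 := kappa12; have e0 := dist_small_gt0 hp.
have d1 := delta1_gt0 hp hM.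
have m0 : 0 < 4 / M ^+ 2 by rewrite divr_gt0 ?exprn_gt0.
have Ci : delta1 M alpha beta < C i.
  apply: le_lt_trans (delta1_le _ _ hM) _.
  have -> : C i = 4 / M ^+ 2 * omega (D i / 2).
    by rewrite D_gap; field; rewrite gt_eqF.
  by rewrite ltr_pM2l//; apply: omega_lt; lra.
have : C i <= delta1 M alpha beta; last by lra.
apply: le_trans (gap_linear h1) _.
rewrite mulrC -ler_pdivlMr// -[leRHS]lnK ?posrE ?divr_gt0// ler_expR.
rewrite lerNl -lnV ?posrE ?divr_gt0// invf_div.
have : ln (C 0%N / delta1 M alpha beta) <= kappa^-1 * i%:R.
  by rewrite ler_pdivlMl//; lra.
move=> h; apply: le_trans h _; rewrite mulrC [leRHS]mulrCA ler_wpM2l//.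
have -> : 2 * nu = 300 / 137 * kappa^-1 by rewrite /nu; field; apply/eqP; lra.
have : 0 < kappa^-1 by rewrite invr_gt0; lra.
lra.
Qed.

(* The number of [i < t0] may exceed [t0] by one; the excess occurs only if [D 0] is
   bounded below, and is absorbed by the margin [1 / 25] of [sum_D_bound]. *)
Lemma count_big_D n : d6 * Nbig n <= d6 * t0 + d8 * (D 0%N / 25).
Proof.
have d6p := delta6_gt0 hp.
have d8g := delta8_ge hp.
have d4p := delta4_gt0 hp.
have t00 : 0 <= t0 by rewrite le_max PB_ge0.
have D0 := D_ge0 0%N.
have d46 := mulr_gt0 d4p d6p.
have [big|small] := ltP eps (D 0%N); last first.
  have -> : Nbig n = 0.
    rewrite /Nbig big1// => i _; have := D_nonincr (leq0n i).
    by case: ltP => // h1 h2; have := lt_le_trans h1 (le_trans h2 small); rewrite ltxx.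
  by rewrite mulr0 addr_ge0// mulr_ge0//; lra.
(* At the last index [i] with [eps < D i] the count is at most [i + 1], and [i < t0]. *)
have N1 : Nbig n <= t0 + 1.
  have aux m : Nbig m <= m%:R.
    elim: m => [|m IH]; first by rewrite /Nbig big_ord0.
    rewrite /Nbig big_ord_recr/= -natr1 lerD//.
    by case: ltP => _; rewrite ?ler01.
  elim: n => [|n IH]; first by rewrite /Nbig big_ord0; lra.
  have [hn|hn] := ltP eps (D n).
    by apply: le_trans (aux _) _; rewrite -natr1; have := big_D_early hn; lra.
  by rewrite /Nbig big_ord_recr/= ltNge hn/= addr0.
apply: le_trans (_ : d6 * (t0 + 1) <= _); first by rewrite ler_wpM2l// ltW.
have h := delta4_dist_small hp.
have : d4 * eps <= d4 * D 0%N by rewrite ler_wpM2l// ltW.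
move=> h1; have h2 := le_trans h h1.
have : d6 * (25 / 2) <= d6 * (d4 * D 0%N) by rewrite ler_wpM2l// ltW.
have : 2 * d4 * d6 * D 0%N <= d8 * D 0%N by rewrite ler_wpM2r.
lra.
Qed.

Lemma ratio_prod n : C n / C 0%N = \prod_(i < n) (C i.+1 / C i).
Proof.
elim: n => [|n IH]; first by rewrite big_ord0 divff// gt_eqF.
by rewrite big_ord_recr/= -IH; field; rewrite !gt_eqF.
Qed.

Theorem superlinear_bound n : (1 <= n)%N ->
  C n / C 0%N <= ((d6 * t0 + d7 * PT 0%N + d8 * D 0%N * (PB 0%N + kappa)) / n%:R) ^+ n.
Proof.
move=> n1; rewrite ratio_prod.
have r0 i : 0 <= C i.+1 / C i by rewrite divr_ge0// ltW.
have := @leif_AGM R 'I_n 'I_n (fun i => C i.+1 / C i) (fun i _ => r0 i).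
move=> [+ _]; rewrite card_ord => h; apply: le_trans h _.
have s0 : 0 <= \sum_(i < n) C i.+1 / C i by apply: sumr_ge0 => i _.
have np : 0 < n%:R :> R by rewrite ltr0n.
have S : \sum_(i < n) C i.+1 / C i <=
    d6 * t0 + d7 * PT 0%N + d8 * D 0%N * (PB 0%N + kappa).
  apply: le_trans (_ : \sum_(i < n) - ln (a i) <= _).
    apply: ler_sum => i _; have := ln_le_sub1 (a_gt0 i); rewrite /a; lra.
  apply: le_trans (sum_step_bound n) _.
  have d8p : 0 <= d8 by rewrite d8E; have := K_ge0; have := A_ge0; lra.
  have d7p : 0 <= d7 by rewrite /delta7; have := A_ge0; lra.
  have := ler_wpM2l d8p (sum_D_bound n).
  have := ler_wpM2l d7p (PT_ge0 n).
  have := count_big_D n; lra.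
by apply: lerXn2r; rewrite ?nnegrE ?divr_ge0 ?(le_trans s0 S)// ler_pM2r ?invr_gt0.
Qed.

End Summation.

(** * One-step estimates along a BFGS run *)

Section Run.
Variables (R : realType) (d : nat) (f : 'cV[R]_d -> R) (M : R) (xs : 'cV[R]_d).
Variables (g : 'cV[R]_d -> 'cV[R]_d) (Hs : 'cV[R]_d -> 'M[R]_d) (S : 'M[R]_d).
Hypothesis model : self_concordant_model f M xs g Hs S.
Variables (alpha beta : R).
Hypothesis hp : armijo_wolfe_params alpha beta.
Variables (x : nat -> 'cV[R]_d) (B : nat -> 'M[R]_d) (eta : nat -> R).
Let p t := - (invmx (B t) *m g (x t)).
Let s t := x t.+1 - x t.
Let y t := g (x t.+1) - g (x t).
Hypothesis hB0 : posdefmx (B 0%N).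
Hypothesis g_neq0 : forall t, g (x t) != 0.
Hypothesis eta_gt0 : forall t, 0 < eta t.
Hypothesis x_step : forall t, x t.+1 = x t + eta t *: p t.
Hypothesis B_step : forall t, B t.+1 = bfgs_update (B t) (s t) (y t).
Hypothesis armijo : forall t,
  f (x t + eta t *: p t) <= f (x t) + alpha * eta t * dot (g (x t)) (p t).
Hypothesis wolfe : forall t,
  beta * dot (g (x t)) (p t) <= dot (g (x t + eta t *: p t)) (p t).
Hypothesis unit_first : forall t,
  f (x t + 1 *: p t) <= f (x t) + alpha * 1 * dot (g (x t)) (p t) ->
  beta * dot (g (x t)) (p t) <= dot (g (x t + 1 *: p t)) (p t) -> eta t = 1.

Local Notation N := (min_norm xs Hs).
Local Notation D t := (Dgap f M xs (x t)).
Local Notation C t := (gap f xs (x t)).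
Local Ltac params := case: (hp) => ? ? ? ?.

(** As [B p = - g], this is [p^T B p]. Below, [G] is the squared dual norm of the gradient in the
    metric at [xs], and [rho] compares [B] with the Hessian at [xs] along [p]. *)
Let e t := - dot (g (x t)) (p t).
Let G t := dot (invmx S *m g (x t)) (invmx S *m g (x t)).
Let sy t := dot (s t) (y t).
Let rho t := e t / N (p t) ^+ 2.

Let sE t : s t = eta t *: p t.
Proof. by rewrite /s x_step addrC addKr. Qed.

Let syE t : sy t = eta t * (dot (g (x t.+1)) (p t) + e t).
Proof. by rewrite /sy sE dotZl dotC /y dotBl. Qed.

Let Bp t : posdefmx (B t) -> B t *m p t = - g (x t).
Proof. by move=> pB; rewrite mulmxN mulKVmx// posdefmx_unit. Qed.

Let p_neq0 t : posdefmx (B t) -> p t != 0.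
Proof.
move=> pB; apply: contra (g_neq0 t) => /eqP p0.
by rewrite -oppr_eq0 -(Bp pB) p0 mulmx0.
Qed.

Let e_gt0' t : posdefmx (B t) -> 0 < e t.
Proof.
move=> pB; rewrite /e dotC -dotNr -(Bp pB).
by have [_] := pB; apply; exact: p_neq0.
Qed.

Let sy_ge' t : posdefmx (B t) -> (1 - beta) * (eta t * e t) <= sy t.
Proof.
move=> pB; rewrite syE mulrCA ler_pM2l//.
by have := wolfe t; rewrite -x_step /e; lra.
Qed.

(** The Wolfe condition makes [s^T y] positive, which preserves definiteness. The preceding facts
    assume [posdefmx (B t)] so that this induction can use them. *)
Lemma B_posdef t : posdefmx (B t).
Proof.
elim: t => [//|t pB]; rewrite B_step; apply: posdefmx_bfgs_update => //.
  by rewrite sE scaler_eq0 negb_or gt_eqF//= p_neq0.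
apply: lt_le_trans (sy_ge' pB); params.
by rewrite !mulr_gt0 ?e_gt0'//; lra.
Qed.

Let e_gt0 t : 0 < e t := e_gt0' (B_posdef t).
Let sy_ge t : (1 - beta) * (eta t * e t) <= sy t := sy_ge' (B_posdef t).

Let sy_gt0 t : 0 < sy t.
Proof.
apply: lt_le_trans (sy_ge t); params.
by rewrite !mulr_gt0//; lra.
Qed.

Lemma gap_armijo t : C t.+1 <= C t - alpha * (eta t * e t).
Proof. by have := armijo t; rewrite -x_step /gap /e; lra. Qed.

Lemma gap_decr t : C t.+1 < C t.
Proof.
params; have := gap_armijo t.
have : 0 < alpha * (eta t * e t) by rewrite !mulr_gt0.
lra.
Qed.

Lemma gap_gt0 t : 0 < C t.
Proof. by apply: le_lt_trans (gap_decr t); exact: (gap_ge0 model). Qed.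

Let near t : near_min M xs Hs (D t) (x t) := near_min_Dgap model (x t).

Let nearS z t : f z <= f (x t) -> near_min M xs Hs (D t) z.
Proof. move=> h; apply: le_trans (near_min_Dgap model z) _; exact: (le_Dgap model). Qed.

Let nearS' t : near_min M xs Hs (D t) (x t + s t).
Proof.
rewrite /s addrC subrK; apply: nearS.
by have := gap_decr t; rewrite /gap; lra.
Qed.

Let D_ge0 t : 0 <= D t := Dgap_ge0 model (x t).

Lemma Dgap_decr t : D t <= D 0%N.
Proof.
elim: t => [//|t IH]; apply: le_trans IH; apply: (le_Dgap model).
by have := gap_decr t; rewrite /gap; lra.
Qed.

Let np_gt0 t : 0 < N (p t) ^+ 2.
Proof.
rewrite (min_norm_sqr model).
by have [_] := model_posdef model xs; apply; exact: p_neq0 (B_posdef t).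
Qed.

Let rho_gt0 t : 0 < rho t.
Proof. by rewrite divr_gt0. Qed.

Let rhoE t : rho t * N (p t) ^+ 2 = e t.
Proof. by rewrite divfK// gt_eqF. Qed.

Let G_gt0 t : 0 < G t.
Proof.
apply: dot_gt0; apply: contra (g_neq0 t) => /eqP h.
by rewrite -(mulKVmx (model_root_unit model) (g (x t))) h mulmx0.
Qed.

Let e_cauchy t : e t ^+ 2 <= G t * N (p t) ^+ 2.
Proof.
rewrite /e sqrrN -(dot_inv_sqrt_hessian model) (min_norm_sqrE model).
exact: cauchy_schwarz.
Qed.

Let G_ge t : rho t * e t <= G t.
Proof.
rewrite -(ler_pM2r (np_gt0 t)) mulrAC rhoE -expr2; exact: e_cauchy.
Qed.

Let y_le t : dot (invmx S *m y t) (invmx S *m y t) <= (1 + D t) * sy t.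
Proof.
have := gradient_cocoercive model (near t) (nearS' t).
by rewrite [x t + _]addrC subrK -/(y t) (dotC (y t)).
Qed.

Let sy_lower t : eta t ^+ 2 * N (p t) ^+ 2 <= (1 + D t) * sy t.
Proof.
have := gradient_monotone model (near t) (nearS' t).
rewrite [x t + _]addrC subrK -/(y t) (dotC (y t)) -/(sy t).
rewrite ler_pdivrMr; last by have := D_ge0 t; lra.
by rewrite sE min_normZ exprMn (ger0_norm (ltW (eta_gt0 t))) [leRHS]mulrC.
Qed.

Let gap_le t : C t <= (1 + D t) / 2 * G t := gap_le_gradient model (near t).

Let BT t := invmx S *m B t *m invmx S.

Let sT t := S *m s t.
Let yT t := invmx S *m y t.

Let BT_posdef t : posdefmx (BT t).
Proof.
have sSi : (invmx S)^T = invmx S by rewrite trmx_inv (model_root_sym model).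
rewrite /BT -{1}sSi; apply: posdefmx_congr; first exact: B_posdef.
by rewrite unitmx_inv (model_root_unit model).
Qed.

Let BT_step t : BT t.+1 = bfgs_update (BT t) (sT t) (yT t).
Proof.
rewrite /BT B_step bfgs_update_change_of_basis//.
  exact: model_root_unit model.
exact: model_root_sym model.
Qed.

Let BT_sT t : BT t *m sT t = - eta t *: (invmx S *m g (x t)).
Proof.
rewrite /BT /sT -!mulmxA mulKmx ?(model_root_unit model)// sE -scalemxAr.
by rewrite (Bp (B_posdef t)) -scalemxAr mulmxN scalerN scaleNr.
Qed.

Let sT_BT_sT t : dot (sT t) (BT t *m sT t) = eta t ^+ 2 * e t.
Proof.
rewrite BT_sT dotZr dotC (dot_inv_sqrt_hessian model) sE dotZr /e; ring.
Qed.

Let BT_sT_sqr t : dot (BT t *m sT t) (BT t *m sT t) = eta t ^+ 2 * G t.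
Proof. by rewrite BT_sT dotZl dotZr /G; ring. Qed.

Let sT_yT t : dot (sT t) (yT t) = sy t.
Proof. by rewrite dotC (dot_inv_sqrt_hessian model) dotC. Qed.

Let sT_neq0 t : sT t != 0.
Proof. by apply/eqP => h; have := sy_gt0 t; rewrite -sT_yT h dot0l ltxx. Qed.

Let PT t := Psi (BT t).
Let c := 1 + D 0%N.
(** After division by [c] the term [|y|^2 / (c s^T y)] is at most [1], so the drop of [PB] carries
    no additive error in [D]. *)
Let PB t := Psi ((1 / c) *: BT t).

Let c_gt0 : 0 < c.
Proof. by rewrite /c; have := D_ge0 0%N; lra. Qed.

Let PT_step t : PT t - PT t.+1 =
  G t / e t - dot (yT t) (yT t) / sy t + ln (sy t / (eta t ^+ 2 * e t)).
Proof.
have et := e_gt0 t; have ht := eta_gt0 t; have Gt := G_gt0 t; have st := sy_gt0 t.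
rewrite /PT BT_step Psi_bfgs_update ?sT_yT//.
rewrite sT_BT_sT BT_sT_sqr.
have -> : eta t ^+ 2 * G t / (eta t ^+ 2 * e t) = G t / e t.
  by field; rewrite !gt_eqF//.
ring.
Qed.

(** Scaling [B] and [y] together commutes with the update; both quotients acquire [1 / c], while the
    logarithm is unchanged. *)
Let PB_step t : PB t - PB t.+1 =
  G t / (c * e t) - dot (yT t) (yT t) / (c * sy t) + ln (sy t / (eta t ^+ 2 * e t)).
Proof.
have cp := c_gt0.
have et := e_gt0 t; have ht := eta_gt0 t; have Gt := G_gt0 t; have st := sy_gt0 t.
have c0 : 1 / c != 0 by rewrite gt_eqF// divr_gt0.
rewrite /PB BT_step -bfgs_updateZ// Psi_bfgs_update//; last first.
- by rewrite dotZr sT_yT mulr_gt0// divr_gt0.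
- by apply: posdefmxZ => //; rewrite divr_gt0.
rewrite -!scalemxAl !(dotZl, dotZr) sT_yT sT_BT_sT BT_sT_sqr.
have -> : 1 / c * (1 / c * (eta t ^+ 2 * G t)) / (1 / c * (eta t ^+ 2 * e t)) =
    G t / (c * e t) by field; rewrite !gt_eqF//.
have -> : 1 / c * (1 / c * dot (yT t) (yT t)) / (1 / c * sy t) =
    dot (yT t) (yT t) / (c * sy t) by field; rewrite !gt_eqF//.
have -> : 1 / c * sy t / (1 / c * (eta t ^+ 2 * e t)) = sy t / (eta t ^+ 2 * e t).
  by field; rewrite !gt_eqF//.
ring.
Qed.

(* [exp (- L t)] is [(g^T s)^2 / (|g|^2 s^T y)] in the metric of [Hs xs], the only
   factor of the decrease ratio [a t] that depends on the Hessian approximation. *)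
Let L t := ln (G t / e t) + ln (sy t / (eta t ^+ 2 * e t)).

(** Apply [ln z <= z - 1] to [z = G t / e t] and bound the [y] quotient by cocoercivity. *)
Let L_le_PT t : L t <= PT t - PT t.+1 + D t.
Proof.
have et := e_gt0 t; have ht := eta_gt0 t; have Gt := G_gt0 t; have st := sy_gt0 t.
rewrite PT_step /L.
have h : 0 < G t / e t by rewrite divr_gt0.
have := ln_le_sub1 h.
have : dot (yT t) (yT t) / sy t <= 1 + D t by rewrite ler_pdivrMr//; exact: y_le.
lra.
Qed.

Let L_le_PB t : L t - ln c <= PB t - PB t.+1.
Proof.
have cp := c_gt0.
have et := e_gt0 t; have ht := eta_gt0 t; have Gt := G_gt0 t; have st := sy_gt0 t.
rewrite PB_step /L.
have h : 0 < G t / (c * e t) by rewrite divr_gt0// mulr_gt0.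
have := ln_le_sub1 h.
have -> : ln (G t / (c * e t)) = ln (G t / e t) - ln c.
  by rewrite -ln_div ?posrE ?divr_gt0//; congr ln; field; rewrite !gt_eqF//.
have : dot (yT t) (yT t) / (c * sy t) <= 1.
  rewrite ler_pdivrMr ?mulr_gt0// mul1r; apply: le_trans (y_le t) _.
  by rewrite ler_pM2r// /c lerD2l Dgap_decr.
lra.
Qed.

Let a t := 1 - C t.+1 / C t.

(** The hypothesis says that [P] is a lower bound for [p q n], where
    [p = (C t - C t.+1) / (eta t * e t)], [q = G t / C t] and [n = sy t / (eta t * e t)]. *)
Let a_factor t P : 0 < P ->
  P * (eta t * e t) ^+ 2 <= (C t - C t.+1) * (G t / C t) * sy t ->
  - ln (a t) <= L t - ln P.
Proof.
have et := e_gt0 t; have ht := eta_gt0 t; have Gt := G_gt0 t; have st := sy_gt0 t.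
move=> P0 h; have ee : 0 < eta t * e t by rewrite mulr_gt0.
have Q0 : 0 < sy t / (eta t ^+ 2 * e t) by rewrite divr_gt0// mulr_gt0// exprn_gt0.
have Ge : 0 < G t / e t by rewrite divr_gt0.
have a0 : 0 < a t by rewrite /a subr_gt0 ltr_pdivrMr ?gap_gt0// mul1r gap_decr.
set Q := sy t / _ in Q0; set Ge' := G t / e t in Ge.
have GQ0 : 0 < Ge' * Q by rewrite mulr_gt0.
have -> : L t - ln P = ln (Ge' * Q / P).
  by rewrite /L (@ln_div _ (Ge' * Q) P) ?posrE// (@lnM _ Ge' Q) ?posrE.
rewrite lerNl -lnV ?posrE ?divr_gt0// ler_ln ?posrE ?invr_gt0 ?divr_gt0// invf_div.
rewrite ler_pdivrMr//.
rewrite -(ler_pM2r (_ : 0 < (eta t * e t) ^+ 2)) ?exprn_gt0//.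
apply: le_trans h _.
rewrite le_eqVlt; apply/orP; left; apply/eqP.
by rewrite /a /Ge' /Q; field; rewrite !gt_eqF// gap_gt0.
Qed.

(** Armijo gives [p >= alpha], gradient domination [q >= 2 / (1 + D t)], and Wolfe
    [n >= 1 - beta]. *)
Let linear_P t : 2 * alpha * (1 - beta) / (1 + D t) * (eta t * e t) ^+ 2 <=
  (C t - C t.+1) * (G t / C t) * sy t.
Proof.
have et := e_gt0 t; have ht := eta_gt0 t; have Gt := G_gt0 t; have st := sy_gt0 t.
params; have D0 := D_ge0 t; have C0 := gap_gt0 t.
have ee : 0 < eta t * e t by rewrite mulr_gt0.
have q : 2 / (1 + D t) <= G t / C t.
  rewrite ler_pdivlMr// mulrC -ler_pdivlMr ?divr_gt0//; last lra.
  by apply: le_trans (gap_le t) _; rewrite invf_div mulrC.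
have dC : alpha * (eta t * e t) <= C t - C t.+1 by have := gap_armijo t; lra.
have -> : 2 * alpha * (1 - beta) / (1 + D t) * (eta t * e t) ^+ 2 =
  (alpha * (eta t * e t)) * (2 / (1 + D t)) * ((1 - beta) * (eta t * e t)).
  by field; apply/eqP; lra.
have q0 : 0 <= 2 / (1 + D t) by rewrite divr_ge0//; lra.
have a0 : 0 <= alpha * (eta t * e t) by rewrite mulr_ge0 ?ltW.
have b0 : 0 <= (1 - beta) * (eta t * e t) by rewrite mulr_ge0 ?ltW//; lra.
by apply: ler_pM => //; [rewrite mulr_ge0|apply: ler_pM].
Qed.

Let ab_gt0 : 0 < 2 * alpha * (1 - beta).
Proof. by params; rewrite !mulr_gt0//; lra. Qed.

Let oneD t : 0 < 1 + D t.
Proof. by have := D_ge0 t; lra. Qed.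

Let ln_linear t : - ln (a t) <= L t + ln (1 + D t) - ln (2 * alpha * (1 - beta)).
Proof.
have h : 0 < 2 * alpha * (1 - beta) / (1 + D t) by rewrite divr_gt0.
by have := a_factor h (linear_P t); rewrite ln_div ?posrE//; lra.
Qed.

Lemma run_global t :
  - ln (a t) <= delta6 alpha beta + (PT t - PT t.+1) + 2 * D t.
Proof.
have := ln_linear t; have := L_le_PT t.
have : ln (1 + D t) <= D t by rewrite le_ln1Dx//; have := D_ge0 t; lra.
by rewrite /delta6 mul1r lnV ?posrE//; lra.
Qed.

Lemma run_linear t :
  - ln (a t) <= ln (c ^+ 2 / (2 * alpha * (1 - beta))) + (PB t - PB t.+1).
Proof.
have := ln_linear t; have := L_le_PB t.
have : ln (1 + D t) <= ln c by rewrite ler_ln ?posrE// /c lerD2l Dgap_decr.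
by rewrite ln_div ?posrE ?exprn_gt0// lnXn// mulr2n; lra.
Qed.

(** In [PT_step], Cauchy-Schwarz gives [G / e >= rho], and strong monotonicity gives
    [sy / (eta^2 e) >= 1 / (rho (1 + D))]; what remains is [rho - 1 - ln rho] up to
    [D + ln (1 + D)]. *)
Lemma run_omega t : omega (rho t - 1) <= PT t - PT t.+1 + 2 * D t.
Proof.
have rt := rho_gt0 t; have Dt := oneD t.
have et := e_gt0 t; have ht := eta_gt0 t; have Gt := G_gt0 t; have st := sy_gt0 t.
rewrite PT_step /omega [1 + (_ - 1)]addrC subrK.
have : dot (yT t) (yT t) / sy t <= 1 + D t by rewrite ler_pdivrMr//; exact: y_le.
have : rho t <= G t / e t by rewrite ler_pdivlMr//; exact: G_ge.
have : - (ln (rho t) + ln (1 + D t)) <= ln (sy t / (eta t ^+ 2 * e t)).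
  have rD : 0 < rho t * (1 + D t) by rewrite mulr_gt0.
  have -> : - (ln (rho t) + ln (1 + D t)) = ln (rho t * (1 + D t))^-1.
    by rewrite lnV ?posrE// (@lnM _ (rho t)) ?posrE.
  have Q0 : 0 < sy t / (eta t ^+ 2 * e t) by rewrite divr_gt0// mulr_gt0// exprn_gt0.
  rewrite ler_ln ?posrE ?invr_gt0//.
  have h2e : 0 < eta t ^+ 2 * e t by rewrite mulr_gt0// exprn_gt0.
  rewrite ler_pdivlMr// mulrC ler_pdivrMr//.
  have := ler_wpM2l (ltW rt) (sy_lower t).
  by have := rhoE t; move: (rho t) => r <-; lra.
have : ln (1 + D t) <= D t by rewrite le_ln1Dx//; have := D_ge0 t; lra.
lra.
Qed.

(** A bootstrap. The bounds on [rho] and [D] give [M * N (p t) <= 17 / 240], so the trial point lies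
    within [1 / 16 + 17 / 240 = 2 / 15]. The quadratic bound there shows that [f] does not increase,
    which returns the trial point to the sublevel set and to radius [D t]. *)
Let near_unit t : D t <= 1 / 16 -> 15 / 16 <= rho t ->
  near_min M xs Hs (D t) (x t + p t).
Proof.
move=> D1 r1; apply: nearS; have D0 := D_ge0 t; have r0 := rho_gt0 t.
have Np0 : 0 <= N (p t) := min_norm_ge0 _ _ _.
have N0 : 0 <= N (x t - xs) := min_norm_ge0 _ _ _.
have M0 := model_param_gt0 model.
have Np : rho t * N (p t) <= (1 + D t) * N (x t - xs).
  have a1 : 0 <= rho t * N (p t) := mulr_ge0 (ltW r0) Np0.
  have a2 : 0 <= (1 + D t) * N (x t - xs) by rewrite mulr_ge0//; lra.
  rewrite -(@ler_pXn2r _ 2) ?nnegrE//.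
  rewrite exprMn [leRHS]exprMn; apply: le_trans (gradient_le_dist model (near t)).
  by rewrite [rho t ^+ 2]expr2 -mulrA rhoE; exact: G_ge.
have MNp : M * N (p t) <= 17 / 240.
  have h1 : rho t * (M * N (p t)) <= (1 + D t) * (M * N (x t - xs)).
    by have := ler_wpM2l (ltW M0) Np; lra.
  have h2 : (1 + D t) * (M * N (x t - xs)) <= (1 + 1 / 16) * (1 / 16).
    apply: ler_pM; rewrite ?mulr_ge0//; try lra.
    exact: le_trans (near t) D1.
  have h3 : 15 / 16 * (M * N (p t)) <= rho t * (M * N (p t)).
    by apply: ler_wpM2r => //; exact: mulr_ge0 (ltW M0) Np0.
  lra.
have near1 : near_min M xs Hs (2 / 15) (x t).
  by apply: le_trans (near t) _; lra.
have near2 : near_min M xs Hs (2 / 15) (x t + p t).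
  rewrite /near_min addrAC; have := min_normD model (x t - xs) (p t).
  move=> h; apply: le_trans (ler_wpM2l (ltW M0) h) _.
  by have := near t; rewrite /near_min; lra.
have := quadratic_upper model near1 near2.
have -> : dot (g (x t)) (p t) = - e t by rewrite /e opprK.
have : 15 / 16 * N (p t) ^+ 2 <= rho t * N (p t) ^+ 2 by rewrite ler_wpM2r ?sqr_ge0.
by rewrite rhoE; have := np_gt0 t; lra.
Qed.

Let unit_decrease t : D t <= 1 / 16 -> 15 / 16 <= rho t ->
  f (x t + p t) <= f (x t) - e t * (1 - (1 + D t) / (2 * rho t)).
Proof.
have rt := rho_gt0 t; have Dt := oneD t.
have et := e_gt0 t; have ht := eta_gt0 t; have Gt := G_gt0 t; have st := sy_gt0 t.
move=> D1 r1; have := quadratic_upper model (near t) (near_unit D1 r1).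
have -> : dot (g (x t)) (p t) = - e t by rewrite /e opprK.
have -> : (1 + D t) / 2 * N (p t) ^+ 2 = e t * ((1 + D t) / (2 * rho t)).
  by rewrite -rhoE; field; rewrite gt_eqF.
lra.
Qed.

Let unit_curvature t : D t <= 1 / 16 -> 15 / 16 <= rho t ->
  e t / (rho t * (1 + D t)) <= dot (g (x t + p t)) (p t) + e t.
Proof.
have rt := rho_gt0 t; have Dt := oneD t.
have et := e_gt0 t; have ht := eta_gt0 t; have Gt := G_gt0 t; have st := sy_gt0 t.
move=> D1 r1; have := gradient_monotone model (near t) (near_unit D1 r1).
rewrite dotBl; have -> : N (p t) ^+ 2 / (1 + D t) = e t / (rho t * (1 + D t)).
  by rewrite -rhoE; field; rewrite !gt_eqF//.
by rewrite /e; lra.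
Qed.

(** Armijo follows from [1 + D <= q <= rho * q^2 = 2 * rho * (1 - alpha)], and Wolfe from [rho * (1
    + D) <= delta3^2 = 1 / (1 - beta)]. *)
Let eta_unit t : D t <= dist_small alpha beta ->
  delta2 alpha <= rho t <= delta3 beta -> eta t = 1.
Proof.
params; rewrite /dist_small !le_min => /and3P[D1 D2 D3] /andP[r2 r3].
have r1 : 15 / 16 <= rho t := le_trans (delta2_ge alpha) r2.
have D0 := D_ge0 t; have r0 := rho_gt0 t; have e0 := e_gt0 t.
have hq := sqrt_armijo_gt1 hp; have hqq := sqr_sqrt_armijo hp.
have h3 := delta3_gt1 hp; have h33 := sqr_delta3 hp.
have h2q := delta2_sqrt_ge1 hp.
set q := Num.sqrt _ in hq hqq h2q D2.
apply: unit_first; rewrite scale1r.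
  apply: le_trans (unit_decrease D1 r1) _.
  have -> : dot (g (x t)) (p t) = - e t by rewrite /e opprK.
  suff : e t * alpha <= e t * (1 - (1 + D t) / (2 * rho t)) by lra.
  rewrite ler_pM2l// lerBrDl -lerBrDr ler_pdivrMr; last lra.
  have : 1 * q <= rho t * q * q.
    rewrite ler_pM2r; last lra.
    by apply: le_trans h2q _; rewrite ler_pM2r; lra.
  by rewrite -mulrA hqq; lra.
have := unit_curvature D1 r1.
have : (1 - beta) * e t <= e t / (rho t * (1 + D t)).
  rewrite ler_pdivlMr; last exact: mulr_gt0 r0 (oneD t).
  have k : (1 - beta) * (rho t * (1 + D t)) <= 1.
    rewrite -[leRHS]h33 ler_pM2l; last lra.
    by apply: ler_pM; lra.
  by have := ler_wpM2r (ltW e0) k; lra.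
by rewrite /e; lra.
Qed.

Lemma run_good t : D t <= dist_small alpha beta ->
  delta2 alpha <= rho t <= delta3 beta ->
  - ln (a t) <= PT t - PT t.+1 + delta5 alpha beta * omega (rho t - 1)
    + D t * (2 + (2 * delta2 alpha - 1 / 16 - ln (delta2 alpha))
                 / (2 * delta2 alpha - 17 / 16)).
Proof.
have rt := rho_gt0 t; have Dt := oneD t.
have et := e_gt0 t; have ht := eta_gt0 t; have Gt := G_gt0 t; have st := sy_gt0 t.
move=> hD hr; have eta1 := eta_unit hD hr.
have /andP[r2 r3] := hr; have D1 : D t <= 1 / 16.
  by apply: le_trans hD _; rewrite /dist_small ge_min lexx.
have r1 : 15 / 16 <= rho t := le_trans (delta2_ge alpha) r2.
have D0 := D_ge0 t; have r0 := rho_gt0 t; have e0 := e_gt0 t; have C0 := gap_gt0 t.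
have xE : x t.+1 = x t + p t by rewrite x_step eta1 scale1r.
have P1 := unit_decrease D1 r1; have P2 := unit_curvature D1 r1.
have W0 : 0 < 2 * rho t - 1 - D t by lra.
(* The product of the bounds for a unit step: [p >= 1 - (1 + D) / (2 * rho)], [q >= 2 / (1 + D)] and
   [n >= 1 / (rho * (1 + D))]. *)
pose P := (2 * rho t - 1 - D t) / (rho t * (1 + D t)) ^+ 2.
have rD : 0 < rho t * (1 + D t) := mulr_gt0 rt Dt.
have P0 : 0 < P by rewrite divr_gt0// exprn_gt0.
have := @a_factor t P P0.
have lnP : ln P = ln (2 * rho t - 1 - D t) - 2 * ln (rho t) - 2 * ln (1 + D t).
  rewrite /P (@ln_div _ (2 * rho t - 1 - D t)) ?posrE ?exprn_gt0//.
  rewrite (lnXn 2 rD) (@lnM _ (rho t)) ?posrE//.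
  by rewrite mulr2n; lra.
have -> : P * (eta t * e t) ^+ 2 =
    e t * (1 - (1 + D t) / (2 * rho t)) * (2 / (1 + D t)) * (e t / (rho t * (1 + D t))).
  by rewrite eta1 /P; field; rewrite !gt_eqF//.
rewrite lnP => h.
have := good_step_bound hp r2 D0 D1.
have := L_le_PT t.
suff /h : e t * (1 - (1 + D t) / (2 * rho t)) * (2 / (1 + D t)) * (e t / (rho t * (1 + D t)))
  <= (C t - C t.+1) * (G t / C t) * sy t by lra.
have q : 2 / (1 + D t) <= G t / C t.
  rewrite ler_pdivlMr// mulrC -ler_pdivlMr ?divr_gt0//.
  by apply: le_trans (gap_le t) _; rewrite invf_div mulrC.
have q0 : 0 <= 2 / (1 + D t) by rewrite divr_ge0 ?ltW.
have w0 : 0 <= e t * (1 - (1 + D t) / (2 * rho t)).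
  rewrite mulr_ge0 ?ltW// subr_gt0 ltr_pdivrMr; lra.
have w1 := mulr_ge0 w0 q0.
have w2 : 0 <= e t / (rho t * (1 + D t)) := ltW (divr_gt0 et rD).
apply: ler_pM => //.
- apply: ler_pM => //.
  by rewrite /gap xE; lra.
- by rewrite syE eta1 mul1r xE.
Qed.

Theorem run_superlinear n : (1 <= n)%N ->
  C n / C 0%N <= ((delta6 alpha beta *
     Num.max (PB 0%N) (3 * c ^+ 2 / (alpha * (1 - beta)) * ln (C 0%N / delta1 M alpha beta))
   + delta7 alpha beta * PT 0%N
   + delta8 alpha beta * D 0%N * (PB 0%N + 3 * c ^+ 2 / (alpha * (1 - beta)))) / n%:R) ^+ n.
Proof.
apply: (@superlinear_bound _ _ _ M hp (model_param_gt0 model)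
  (fun t => C t) (fun t => D t) PT PB rho).
- exact: gap_gt0.
- exact: gap_decr.
- exact: D_ge0.
- by move=> t; exact: (omega_Dgap model).
- by move=> t; exact: Psi_ge0 (BT_posdef t).
- by move=> t; apply/Psi_ge0/posdefmxZ; rewrite ?divr_gt0.
- exact: rho_gt0.
- exact: run_global.
- exact: run_linear.
- exact: run_omega.
- exact: run_good.
Qed.

End Run.

(** * Instantiation with the gradient and Hessian of [f] *)

Lemma self_concordant_model_hessian (R : realType) (d : nat) (f : 'cV[R]_d -> R) (M : R)
    (xs : 'cV[R]_d) :
  twice_differentiable f -> strictly_convex f -> 0 < M ->
  strongly_self_concordant M f -> minimizer f xs ->
  self_concordant_model f M xs (gradient f) (hessian f) (sqrtmx (hessian f xs)).
Proof.
move=> [df dg] hfc hM hfM hxs; have [pS SS] := sqrtmxP (hfc xs).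
split=> //.
- by move=> x v t; apply: is_derive_line.
- by move=> x v w t; apply: is_derive_gradient_line => //; have [] := hfc (x + t *: v).
- by move=> x y z u; exact: loewner_le_quad (hfM x y z).
- by case: pS.
- exact: posdefmx_unit.
Qed.

Theorem theorem4p3 (R : realType) (d : nat) (f : 'cV[R]_d -> R) (M : R)
    (xs : 'cV[R]_d) (alpha beta : R)
    (x : nat -> 'cV[R]_d) (B : nat -> 'M[R]_d) (eta : nat -> R)
    (hf2 : twice_differentiable f)
    (hfc : strictly_convex f)
    (hM : 0 < M)
    (hfM : strongly_self_concordant M f)
    (hxs : minimizer f xs)
    (halpha : 0 < alpha) (halphabeta : alpha < beta) (hbeta : beta < 1)
    (halpha2 : alpha < 1 / 2)
    (hB0 : posdefmx (B 0%N))
    (hrun : bfgs_run f x B eta)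
    (hAW : forall t : nat,
       armijo_wolfe f alpha beta (x t) (bfgs_direction f (B t) (x t)) (eta t))
    (hunit : forall t : nat,
       armijo_wolfe f alpha beta (x t) (bfgs_direction f (B t) (x t)) 1 ->
       eta t = 1) :
  let C0 := gap f xs (x 0%N) in
  let D0 := Dgap f M xs (x 0%N) in
  let tB0 := tildemx f xs (B 0%N) in
  let bB0 := (1 / (1 + D0)) *: tB0 in
  let kappa := 3 * (1 + D0) ^+ 2 / (alpha * (1 - beta)) in
  let t0 := Num.max (Psi bB0) (kappa * ln (C0 / delta1 M alpha beta)) in
  forall t : nat, (1 <= t)%N ->
    (f (x t) - f xs) / (f (x 0%N) - f xs) <=
    ((delta6 alpha beta * t0 + delta7 alpha beta * Psi tB0
      + delta8 alpha beta * D0 * (Psi bB0 + kappa)) / t%:R) ^+ t.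
Proof.
have model := self_concordant_model_hessian hf2 hfc hM hfM hxs.
have hp : armijo_wolfe_params alpha beta by split.
move=> C0 D0 tB0 bB0 kappa t0 t t1.
apply: (run_superlinear (eta := eta) model hp hB0) => //.
- by move=> n; case: (hrun n).
- by move=> n; case: (hrun n).
- by move=> n; case: (hrun n).
- by move=> n; case: (hrun n).
- by move=> n; case: (hAW n).
- by move=> n; case: (hAW n).
- by move=> n h1 h2; apply: hunit.
Qed.
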